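(* Let $T_1$ be the unique positive solution of $\coth T=T$. For $T>0$ let $g_T$ be the flat product metric on the cylinder $\mathbb{S}^1\times[-T,T]$, where $\mathbb{S}^1$ is a circle of length $2\pi$. Then for every $0<T<T_1$ the metric $g_T$ is not $\bar\sigma_1$-conformally maximal, i.e. there exists a smooth metric $h\in[g_T]$ with $\bar\sigma_1(\mathbb{S}^1\times[-T,T],h)>\bar\sigma_1(\mathbb{S}^1\times[-T,T],g_T)$. In particular, for every $0<T<T_1$ there are no rotationally symmetric $\bar\sigma_1$-conformally maximal metrics in the conformal class $[g_T]$.
   Context: For a compact connected Riemannian surface $(N,g)$ with non-empty boundary, a number $\sigma$ is a Steklov eigenvalue if there is a nontrivial solution of $\Delta_g u=0$ on $N$, $\partial_n u=\sigma u$ on $\partial N$, where $\partial_n$ is the outward unit normal derivative. The Steklov eigenvalues, repeated with multiplicity, form a sequence $0=\sigma_0(N,g)<\sigma_1(N,g)\leq\sigma_2(N,g)\leq\cdots\nearrow+\infty$. The conformal class of $g$ is $[g]=\{e^{2\omega}g:\omega\in C^\infty(N)\}$. Set $\bar\sigma_k(N,h)=\sigma_k(N,h)\,\mathrm{Length}(\partial N,h)$ and $\Sigma_k(N,[g])=\sup_{h\in[g]}\bar\sigma_k(N,h)$. A metric $h\in[g]$ is called $\bar\sigma_k$-conformally maximal if $\bar\sigma_k(N,h)=\Sigma_k(N,[g])$. A metric on $\mathbb{S}^1\times[-T,T]$ is rotationally symmetric if it is invariant under the rotations of the $\mathbb{S}^1$ factor. *)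

(* Defs.v *)
From Stdlib Require Import Reals Lra.
From Coquelicot Require Import Coquelicot.

Open Scope R_scope.

(** The cylinder S^1 x [-T,T], with S^1 = R/2 pi Z, is described by its global
    coordinates (x, t): x in R is the angle modulo 2 pi and -T <= t <= T.

    A function is smooth on a manifold with boundary when it is smooth up to the
    boundary, i.e. it extends smoothly across it.  Smooth functions on the
    cylinder are therefore given by a smooth 2 pi-periodic extension to
    R x R; every notion below depends only on its values for -T <= t <= T
    (the derivatives at t = T and t = -T are one-sided limits of these). *)

Definition smooth (f : R -> R -> R) : Prop :=
  (forall (n : nat) (x t : R), ex_diff_n f n x t) /\
  (forall x t : R, f (x + 2 * PI) t = f x t).

Definition in_cylinder (T t : R) : Prop := - T <= t <= T.

Definition dx (f : R -> R -> R) (x t : R) : R := Derive (fun z => f z t) x.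
Definition dt (f : R -> R -> R) (x t : R) : R := Derive (fun z => f x z) t.

(** The Riemannian metric  g11 dx^2 + 2 g12 dx dt + g22 dt^2. *)
Record metric (T : R) : Type := Metric {
  g11 : R -> R -> R;
  g12 : R -> R -> R;
  g22 : R -> R -> R;
  g11_smooth : smooth g11;
  g12_smooth : smooth g12;
  g22_smooth : smooth g22;
  metric_pos : forall x t a b : R, in_cylinder T t -> (a, b) <> (0, 0) ->
    0 < g11 x t * (a * a) + 2 * g12 x t * (a * b) + g22 x t * (b * b)
}.
Arguments Metric {T}.
Arguments g11 {T}.
Arguments g12 {T}.
Arguments g22 {T}.

Definition inner {T : R} (g : metric T) (x t a b c d : R) : R :=
  g11 g x t * (a * c) + g12 g x t * (a * d + b * c) + g22 g x t * (b * d).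

Definition gdet {T : R} (g : metric T) (x t : R) : R :=
  g11 g x t * g22 g x t - g12 g x t * g12 g x t.

(** Components g^{ij} d_j u of the gradient. *)
Definition grad1 {T : R} (g : metric T) (u : R -> R -> R) (x t : R) : R :=
  (g22 g x t * dx u x t - g12 g x t * dt u x t) / gdet g x t.
Definition grad2 {T : R} (g : metric T) (u : R -> R -> R) (x t : R) : R :=
  (g11 g x t * dt u x t - g12 g x t * dx u x t) / gdet g x t.

(** Laplace-Beltrami operator  |g|^{-1/2} d_i (|g|^{1/2} g^{ij} d_j u). *)
Definition laplacian {T : R} (g : metric T) (u : R -> R -> R) (x t : R) : R :=
  (dx (fun y s => sqrt (gdet g y s) * grad1 g u y s) x t +
   dt (fun y s => sqrt (gdet g y s) * grad2 g u y s) x t) / sqrt (gdet g x t).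

(** [a d/dx + b d/dt] is the outward unit normal at the boundary point (x, t):
    orthogonal to the tangent direction d/dx of the boundary, of length one, and
    pointing out of the cylinder. *)
Definition outward_unit_normal {T : R} (g : metric T) (x t a b : R) : Prop :=
  inner g x t a b 1 0 = 0 /\
  inner g x t a b a b = 1 /\
  ((t = T /\ 0 < b) \/ (t = - T /\ b < 0)).

Definition steklov_eigenfunction {T : R} (g : metric T) (sigma : R)
    (u : R -> R -> R) : Prop :=
  smooth u /\
  (exists x t : R, in_cylinder T t /\ u x t <> 0) /\
  (forall x t : R, in_cylinder T t -> laplacian g u x t = 0) /\
  (forall x t a b : R, outward_unit_normal g x t a b ->
     a * dx u x t + b * dt u x t = sigma * u x t).

Definition lin_indep (T : R) (k : nat) (u : nat -> R -> R -> R) : Prop :=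
  forall c : nat -> R,
    (forall x t : R, in_cylinder T t ->
       sum_f_R0 (fun i => c i * u i x t) k = 0) ->
    forall i : nat, (i <= k)%nat -> c i = 0.

(** There are at least k + 1 eigenvalues <= lambda, counted with multiplicity
    (eigenfunctions for distinct eigenvalues being linearly independent). *)
Definition steklov_count {T : R} (g : metric T) (k : nat) (lambda : R) : Prop :=
  exists (s : nat -> R) (u : nat -> R -> R -> R),
    (forall i : nat, (i <= k)%nat ->
       steklov_eigenfunction g (s i) (u i) /\ s i <= lambda) /\
    lin_indep T k u.

(** The eigenvalue sigma_k, k = 0, 1, ..., of the nondecreasing sequence of
    eigenvalues repeated with multiplicity: the least lambda for which k + 1 of
    them are <= lambda.  It is a finite real number, the spectrum being infinite
    and discrete; [Rbar] is only the codomain of the infimum. *)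
Definition steklov {T : R} (g : metric T) (k : nat) : Rbar :=
  Glb_Rbar (steklov_count g k).

Definition boundary_length {T : R} (g : metric T) : R :=
  RInt (fun x => sqrt (g11 g x T)) 0 (2 * PI) +
  RInt (fun x => sqrt (g11 g x (- T))) 0 (2 * PI).

Definition steklov_bar {T : R} (g : metric T) (k : nat) : Rbar :=
  Rbar_mult (steklov g k) (Finite (boundary_length g)).

Definition conformal_class {T : R} (g h : metric T) : Prop :=
  exists omega : R -> R -> R, smooth omega /\
    forall x t : R, in_cylinder T t ->
      g11 h x t = exp (2 * omega x t) * g11 g x t /\
      g12 h x t = exp (2 * omega x t) * g12 g x t /\
      g22 h x t = exp (2 * omega x t) * g22 g x t.

Definition conformal_sup {T : R} (g : metric T) (k : nat) : Rbar :=
  Rbar_lub (fun v => exists h : metric T,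
    conformal_class g h /\ v = steklov_bar h k).

Definition conformally_maximal {T : R} (g : metric T) (k : nat)
    (h : metric T) : Prop :=
  conformal_class g h /\ steklov_bar h k = conformal_sup g k.

(** Invariance under (x, t) |-> (x + alpha, t), whose differential is the
    identity in these coordinates. *)
Definition rotationally_symmetric {T : R} (g : metric T) : Prop :=
  forall alpha x t : R, in_cylinder T t ->
    g11 g (x + alpha) t = g11 g x t /\
    g12 g (x + alpha) t = g12 g x t /\
    g22 g (x + alpha) t = g22 g x t.

Lemma ex_diff_n_ext (f h : R -> R -> R) (n : nat) (x t : R) :
  (forall y s, f y s = h y s) -> ex_diff_n f n x t -> ex_diff_n h n x t.
Proof.
  revert f h; induction n as [|n IH]; intros f h E [C D]; split.
  - apply continuity_2d_pt_ext with f; auto.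
  - exact I.
  - apply continuity_2d_pt_ext with f; auto.
  - destruct D as (D1 & D2 & D3 & D4); repeat split.
    + apply ex_derive_ext with (fun z => f z t); auto.
    + apply ex_derive_ext with (fun z => f x z); auto.
    + eapply IH; [|exact D3]; intros; apply Derive_ext; auto.
    + eapply IH; [|exact D4]; intros; apply Derive_ext; auto.
Qed.

Lemma smooth_const (c : R) : smooth (fun _ _ => c).
Proof.
  split; [|reflexivity].
  intros n x t; revert c; induction n as [|n IH]; intros c; split.
  - apply continuity_2d_pt_const.
  - exact I.
  - apply continuity_2d_pt_const.
  - repeat split; try apply ex_derive_const;
      (eapply ex_diff_n_ext; [|apply (IH 0)]);
      intros; symmetry; apply Derive_const.
Qed.

Lemma flat_pos (a b : R) : (a, b) <> (0, 0) ->
  0 < 1 * (a * a) + 2 * 0 * (a * b) + 1 * (b * b).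
Proof.
  intros H.
  assert (Ha := Rle_0_sqr a); assert (Hb := Rle_0_sqr b); unfold Rsqr in *.
  destruct (Req_dec a 0) as [A|A]; destruct (Req_dec b 0) as [B|B].
  - subst; now destruct H.
  - assert (P := Rsqr_pos_lt b B); unfold Rsqr in P; lra.
  - assert (P := Rsqr_pos_lt a A); unfold Rsqr in P; lra.
  - assert (P := Rsqr_pos_lt a A); unfold Rsqr in P; lra.
Qed.

Definition flat_metric (T : R) : metric T :=
  Metric (fun _ _ => 1) (fun _ _ => 0) (fun _ _ => 1)
    (smooth_const 1) (smooth_const 0) (smooth_const 1)
    (fun x t a b _ H => flat_pos a b H).

Definition coth (x : R) : R := cosh x / sinh x.

(* Main.v *)
Require Import Defs.
From Stdlib Require Import Reals Lra Lia Psatz ZArith.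
From Coquelicot Require Import Coquelicot.
Open Scope R_scope.

(** Write l = tanh T and call weight of a conformal metric the density of its
    length element on the two boundary circles.  Harmonicity is conformally
    invariant in dimension two, so the Steklov problem of a metric in [g_T] is
    the flat Laplace equation with boundary condition (normal derivative) =
    sigma * weight * u ([steklov_conformal_iff]).

    Upper bound.  If the weight is a constant a on one circle and b on the
    other, functions cos x (A cosh t + B sinh t) give eigenvalues that are roots
    of a quadratic, one of which lies in [0, 2 l / (a + b)].  Together with the
    constants this gives sigma_1 * Length <= 4 pi l for every rotationally
    symmetric metric ([rotational_steklov_le]); the flat one is among them.

    Lower bound.  Put the Poisson weight 1 / (1 + r^2 - 2 r cos x) on both
    circles, with r > 0 small.  Its inverse is a trigonometric polynomial of
    degree one, so if b_k denotes the k-th Fourier coefficient of the sum of the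
    outward normal derivatives at the two ends, the boundary condition becomes
    the three-term recurrence
      (1 + r^2 - sigma / l_k) b_k = r (b_(k+1) + b_(k-1)),   l_k = k tanh (k T),
    with b_0 = 0, and it has the same form in every phase.  For k >= 2 the
    factor 1 + r^2 - sigma / l_k exceeds some d > 1/2, because l_2 = 4 l / (1 +
    l^2) > 2 l.  A bounded solution therefore satisfies |b_2| <= r |b_1| / (d -
    r), whereas k = 1 asks for |b_2| >= 2 r |b_1| when sigma = l (1 - r^2).  As
    1 / (d - r) < 2, only b = 0 remains, and this persists for
    sigma <= l (1 - r^2 + r^3) ([even_flux_zero]).  The part of u odd in t has
    the eigenvalues k coth (k T) >= 1 / T > l, the last inequality being T < T1,
    and is excluded by the same recurrence for small r ([odd_flux_zero]).  Hence
    an eigenfunction with such a sigma is constant ([poisson_weight_rigidity]),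
    and sigma_1 >= l (1 - r^2 + r^3).  The length is at least
    4 pi (1 + r^2 - 5 r^4 - r^6), so that sigma_1 * Length > 4 pi l.

    The choice of weight is explained by the disk, whose conformal automorphisms
    turn the constant weight into the Poisson kernel and leave sigma_1 * Length
    unchanged; on the cylinder the same deformation gains a term of order r^2,
    which is positive because l < 1. *)

(** * Smooth functions on the cylinder *)

Lemma is_derive_continuous (F : R -> R) (x l : R) :
  is_derive F x l -> continuous F x.
Proof.
  intros D; apply (ex_derive_continuous (K := R_AbsRing) (V := R_NormedModule)).
  now exists l.
Qed.

Fixpoint Cn (n : nat) (F : R -> R) : Prop :=
  match n with
  | O => forall x, continuous F x
  | S m => exists F' : R -> R, (forall x, is_derive F x (F' x)) /\ Cn m F'
  end.

Definition Cinf (F : R -> R) : Prop := forall n, Cn n F.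

Lemma Cn_continuous n F : Cn n F -> forall x, continuous F x.
Proof.
  destruct n as [|n]; [auto|].
  intros [F' [D _]] x; exact (is_derive_continuous F x (F' x) (D x)).
Qed.

Lemma Cn_pred n : forall F, Cn (S n) F -> Cn n F.
Proof.
  induction n as [|n IH]; intros F C.
  - exact (Cn_continuous 1 F C).
  - destruct C as [F' [D C]]; exists F'; auto.
Qed.

Lemma Cn_ext n : forall F G, (forall x, F x = G x) -> Cn n F -> Cn n G.
Proof.
  destruct n as [|n]; intros F G E C.
  - intros x; apply continuous_ext with F; auto.
  - destruct C as [F' [D C]]; exists F'; split; auto.
    intros x; apply is_derive_ext with F; auto.
Qed.

Lemma Cn_plus n : forall F G, Cn n F -> Cn n G -> Cn n (fun x => F x + G x).
Proof.
  induction n as [|n IH]; intros F G CF CG.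
  - intros x; apply (continuous_plus F G); auto.
  - destruct CF as [F' [DF CF]], CG as [G' [DG CG]].
    exists (fun x => F' x + G' x); split; auto.
    intros x; apply (is_derive_plus F G x (F' x) (G' x)); auto.
Qed.

Lemma Cn_mult n : forall F G, Cn n F -> Cn n G -> Cn n (fun x => F x * G x).
Proof.
  induction n as [|n IH]; intros F G CF CG.
  - intros x; apply (continuous_mult F G); auto.
  - assert (CF0 := Cn_pred n F CF); assert (CG0 := Cn_pred n G CG).
    destruct CF as [F' [DF CF]], CG as [G' [DG CG]].
    exists (fun x => F' x * G x + F x * G' x); split.
    + intros x; apply (is_derive_mult F G x (F' x) (G' x)); auto.
      exact Rmult_comm.
    + apply Cn_plus; apply IH; auto.
Qed.

Lemma Cn_const n : forall c, Cn n (fun _ => c).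
Proof.
  induction n as [|n IH]; intros c.
  - intros x; apply continuous_const.
  - exists (fun _ => 0); split; auto.
    intros x; apply (is_derive_const c x).
Qed.

Lemma Cinf_const c : Cinf (fun _ => c).
Proof. intros n; apply Cn_const. Qed.

Lemma Cinf_mult F G : Cinf F -> Cinf G -> Cinf (fun x => F x * G x).
Proof. intros HF HG n; apply Cn_mult; auto. Qed.

(** The derivative of 1/F is a product of -F' and two copies of 1/F, which are
    already known to be of class C^n; this drives the induction. *)
Lemma Cn_inv n F : (forall x, F x <> 0) -> Cn n F -> Cn n (fun x => / F x).
Proof.
  intros N; induction n as [|n IH]; intros C.
  - intros x; apply continuous_comp; [apply C|].
    apply continuity_pt_filterlim, continuity_pt_inv; [|apply N].
    apply continuity_pt_id.
  - assert (C0 := IH (Cn_pred n F C)).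
    destruct C as [F' [D C]].
    exists (fun x => (- 1 * F' x) * (/ F x * / F x)); split.
    + intros x; replace (-1 * F' x * (/ F x * / F x)) with (- F' x / F x ^ 2)
        by (field; apply N).
      apply is_derive_inv; auto.
    + repeat apply Cn_mult; auto; apply Cn_const.
Qed.

Lemma Cn_ln n F : (forall x, 0 < F x) -> Cn (S n) F -> Cn (S n) (fun x => ln (F x)).
Proof.
  intros P C; assert (C0 := Cn_pred n F C); destruct C as [F' [D C]].
  exists (fun x => F' x * / F x); split.
  - intros x; apply (is_derive_comp ln F); [|apply D].
    apply is_derive_Reals, derivable_pt_lim_ln, P.
  - apply Cn_mult; auto; apply Cn_inv; auto.
    intros x; apply Rgt_not_eq, P.
Qed.

Lemma Cinf_ln F : (forall x, 0 < F x) -> Cinf F -> Cinf (fun x => ln (F x)).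
Proof. intros P C n; apply Cn_pred, Cn_ln; auto. Qed.

Lemma Cinf_sincos : forall a b, Cinf (fun x => a * cos x + b * sin x).
Proof.
  intros a b n; revert a b; induction n as [|n IH]; intros a b.
  - intros x; apply is_derive_continuous with (- a * sin x + b * cos x).
    auto_derive; auto; ring.
  - exists (fun x => b * cos x + (- a) * sin x); split; auto.
    intros x; auto_derive; auto; ring.
Qed.

Lemma is_derive_cosh x : is_derive cosh x (sinh x).
Proof. apply is_derive_Reals, derivable_pt_lim_cosh. Qed.

Lemma is_derive_sinh x : is_derive sinh x (cosh x).
Proof. apply is_derive_Reals, derivable_pt_lim_sinh. Qed.

Lemma is_derive_coshsinh a b x :
  is_derive (fun t => a * cosh t + b * sinh t) x (b * cosh x + a * sinh x).
Proof.
  rewrite Rplus_comm.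
  apply (is_derive_plus (fun t => a * cosh t) (fun t => b * sinh t) x).
  - apply (is_derive_scal cosh), is_derive_cosh.
  - apply (is_derive_scal sinh), is_derive_sinh.
Qed.

Lemma Cinf_coshsinh : forall a b, Cinf (fun t => a * cosh t + b * sinh t).
Proof.
  intros a b n; revert a b; induction n as [|n IH]; intros a b.
  - intros x; eapply is_derive_continuous, is_derive_coshsinh.
  - exists (fun x => b * cosh x + a * sinh x); split; auto.
    intros x; apply is_derive_coshsinh.
Qed.

Lemma continuity_2d_pt_fst F x t :
  continuous F x -> continuity_2d_pt (fun y _ => F y) x t.
Proof.
  intros C; apply (continuity_1d_2d_pt_comp F (fun y _ => y)).
  - now apply continuity_pt_filterlim.
  - apply continuity_2d_pt_id1.
Qed.

Lemma continuity_2d_pt_snd G x t :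
  continuous G t -> continuity_2d_pt (fun _ s => G s) x t.
Proof.
  intros C; apply (continuity_1d_2d_pt_comp G (fun _ s => s)).
  - now apply continuity_pt_filterlim.
  - apply continuity_2d_pt_id2.
Qed.

Lemma is_derive_scal_r F (c : R) x l :
  is_derive F x l -> is_derive (fun y => F y * c) x (l * c).
Proof.
  intros D; rewrite Rmult_comm.
  apply is_derive_ext with (fun y => c * F y); [intros; apply Rmult_comm|].
  now apply (is_derive_scal F).
Qed.

(** Partial derivatives of a product F(x) G(t) are again such products, so joint
    differentiability reduces to one variable. *)
Lemma ex_diff_n_separated n : forall F G x t, Cn n F -> Cn n G ->
  ex_diff_n (fun y s => F y * G s) n x t.
Proof.
  induction n as [|n IH]; intros F G x t CF CG; split; auto.
  - apply continuity_2d_pt_mult;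
      [apply continuity_2d_pt_fst | apply continuity_2d_pt_snd]; auto.
  - apply continuity_2d_pt_mult;
      [apply continuity_2d_pt_fst | apply continuity_2d_pt_snd];
      eapply Cn_continuous; eauto.
  - assert (CF0 := Cn_pred n F CF); assert (CG0 := Cn_pred n G CG).
    destruct CF as [F' [DF CF]], CG as [G' [DG CG]].
    repeat split.
    + exists (F' x * G t); now apply is_derive_scal_r.
    + exists (F x * G' t); now apply (is_derive_scal G).
    + apply ex_diff_n_ext with (fun y s => F' y * G s); auto.
      intros y s; symmetry; apply is_derive_unique; now apply is_derive_scal_r.
    + apply ex_diff_n_ext with (fun y s => F y * G' s); auto.
      intros y s; symmetry; apply is_derive_unique; now apply (is_derive_scal G).
Qed.

Lemma smooth_separated F G : Cinf F -> Cinf G ->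
  (forall x, F (x + 2 * PI) = F x) -> smooth (fun x t => F x * G t).
Proof.
  intros CF CG P; split.
  - intros n x t; now apply ex_diff_n_separated.
  - intros x t; now rewrite P.
Qed.

Lemma smooth_ext f h : (forall x t, f x t = h x t) -> smooth f -> smooth h.
Proof.
  intros E [D P]; split.
  - intros n x t; now apply ex_diff_n_ext with f.
  - intros x t; rewrite <- !E; apply P.
Qed.

Lemma smooth_fst F : Cinf F -> (forall x, F (x + 2 * PI) = F x) ->
  smooth (fun x _ => F x).
Proof.
  intros C P; apply smooth_ext with (fun x t => F x * 1).
  - intros; ring.
  - apply smooth_separated with (G := fun _ => 1); auto; apply Cinf_const.
Qed.

Lemma smooth_continuity_2d v x t : smooth v -> continuity_2d_pt v x t.
Proof. intros [D _]; exact (proj1 (D 0%nat x t)). Qed.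

Lemma smooth_is_derive_dx v x t :
  smooth v -> is_derive (fun z => v z t) x (dx v x t).
Proof.
  intros [D _]; destruct (D 1%nat x t) as (_ & E & _ & _).
  now apply Derive_correct.
Qed.

Lemma smooth_is_derive_dt v x t :
  smooth v -> is_derive (fun z => v x z) t (dt v x t).
Proof.
  intros [D _]; destruct (D 1%nat x t) as (_ & _ & E & _).
  now apply Derive_correct.
Qed.

(** Periodicity of the derivative comes from the chain rule for the translation
    by 2 pi. *)
Lemma smooth_dx v : smooth v -> smooth (dx v).
Proof.
  intros [D P]; split.
  - intros n x t; destruct (D (S n) x t) as (_ & _ & _ & E & _); exact E.
  - intros x t; unfold dx.
    transitivity (Derive (fun z => v (z + 2 * PI) t) x).
    + symmetry; apply is_derive_unique.
      rewrite <- (Rmult_1_l (Derive (fun z => v z t) (x + 2 * PI))).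
      apply (is_derive_comp (fun z => v z t) (fun z => z + 2 * PI)).
      * apply Derive_correct.
        destruct (D 1%nat (x + 2 * PI) t) as (_ & E & _); exact E.
      * auto_derive; auto.
    + apply Derive_ext; intros; apply P.
Qed.

Lemma smooth_dt v : smooth v -> smooth (dt v).
Proof.
  intros [D P]; split.
  - intros n x t; destruct (D (S n) x t) as (_ & _ & _ & _ & E); exact E.
  - intros x t; unfold dt; apply Derive_ext; intros; apply P.
Qed.

Lemma smooth_continuous_x v x t : smooth v -> continuous (fun z => v z t) x.
Proof.
  intros S; eapply is_derive_continuous; now apply smooth_is_derive_dx.
Qed.

(** * Fourier coefficients on the circle *)

Lemma ex_RInt_cont (f : R -> R) a b : (forall x, continuous f x) -> ex_RInt f a b.
Proof.
  intros C; apply (ex_RInt_continuous (V := R_CompleteNormedModule)); auto.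
Qed.

Lemma RInt_lincomb (f g : R -> R) (p q a b : R) :
  (forall x, continuous f x) -> (forall x, continuous g x) ->
  RInt (fun x => p * f x + q * g x) a b = p * RInt f a b + q * RInt g a b.
Proof.
  intros Cf Cg; apply is_RInt_unique.
  apply (is_RInt_plus (V := R_NormedModule) (fun x => p * f x) (fun x => q * g x)).
  - apply (is_RInt_scal (V := R_NormedModule) f).
    apply (RInt_correct (V := R_CompleteNormedModule)), ex_RInt_cont, Cf.
  - apply (is_RInt_scal (V := R_NormedModule) g).
    apply (RInt_correct (V := R_CompleteNormedModule)), ex_RInt_cont, Cg.
Qed.

Lemma RInt_eq (f g : R -> R) a b :
  (forall x, f x = g x) -> RInt f a b = RInt g a b.
Proof. intros E; apply RInt_ext; auto. Qed.

Lemma RInt_FTC (F f : R -> R) a b :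
  (forall x, is_derive F x (f x)) -> (forall x, continuous f x) ->
  RInt f a b = F b - F a.
Proof.
  intros D C; apply is_RInt_unique.
  apply (is_RInt_derive (V := R_CompleteNormedModule) F f); auto.
Qed.

Lemma continuous_mult_R (f g : R -> R) x :
  continuous f x -> continuous g x -> continuous (fun y => f y * g y) x.
Proof. intros; now apply (continuous_mult f g). Qed.

Lemma continuous_plus_R (f g : R -> R) x :
  continuous f x -> continuous g x -> continuous (fun y => f y + g y) x.
Proof. intros; now apply (continuous_plus f g). Qed.

Lemma RInt_period (f : R -> R) a :
  (forall x, continuous f x) -> (forall x, f (x + 2 * PI) = f x) ->
  RInt f a (a + 2 * PI) = RInt f 0 (2 * PI).
Proof.
  intros C P.
  assert (E1 := RInt_Chasles (V := R_CompleteNormedModule) f a 0 (a + 2 * PI)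
    (ex_RInt_cont f _ _ C) (ex_RInt_cont f _ _ C)).
  assert (E2 := RInt_Chasles (V := R_CompleteNormedModule) f 0 (2 * PI) (a + 2 * PI)
    (ex_RInt_cont f _ _ C) (ex_RInt_cont f _ _ C)).
  assert (E3 := RInt_Chasles (V := R_CompleteNormedModule) f 0 a 0
    (ex_RInt_cont f _ _ C) (ex_RInt_cont f _ _ C)).
  rewrite RInt_point in E3.
  assert (E4 : RInt f (2 * PI) (a + 2 * PI) = RInt f 0 a).
  { assert (H := RInt_comp_lin (V := R_CompleteNormedModule) f 1 (2 * PI) 0 a
      (ex_RInt_cont f _ _ C)).
    replace (1 * 0 + 2 * PI) with (2 * PI) in H by ring.
    replace (1 * a + 2 * PI) with (a + 2 * PI) in H by ring.
    rewrite <- H; apply RInt_eq; intros x.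
    change (1 * f (1 * x + 2 * PI) = f x); now rewrite !Rmult_1_l, P. }
  unfold plus, zero in *; simpl in *; lra.
Qed.

Lemma cos_Zperiod (k : Z) (x : R) : cos (x + IZR k * (2 * PI)) = cos x.
Proof.
  destruct (Z_le_gt_dec 0 k) as [H|H].
  - rewrite <- (Z2Nat.id k H), <- INR_IZR_INZ.
    rewrite <- (cos_period x (Z.to_nat k)); f_equal; ring.
  - rewrite <- (cos_period (x + IZR k * (2 * PI)) (Z.to_nat (- k))); f_equal.
    rewrite INR_IZR_INZ, Z2Nat.id by lia.
    rewrite opp_IZR; ring.
Qed.

Lemma sin_Zperiod (k : Z) (x : R) : sin (x + IZR k * (2 * PI)) = sin x.
Proof.
  rewrite !(sin_cos), <- (cos_Zperiod k (PI / 2 + x)); f_equal; f_equal; ring.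
Qed.

(** The phase th treats cosines and sines at once; integer (rather than natural)
    frequencies make the product formula with cos free of boundary cases. *)
Definition wave (k : Z) (th x : R) : R := cos (IZR k * x + th).

Definition fourier (f : R -> R) (k : Z) (th : R) : R :=
  RInt (fun x => f x * wave k th x) 0 (2 * PI).

Lemma wave_periodic k th x : wave k th (x + 2 * PI) = wave k th x.
Proof.
  unfold wave; rewrite <- (cos_Zperiod k (IZR k * x + th)); f_equal; ring.
Qed.

Lemma wave_continuous k th x : continuous (wave k th) x.
Proof.
  unfold wave; apply is_derive_continuous with (- IZR k * sin (IZR k * x + th)).
  auto_derive; auto; ring.
Qed.

Lemma wave_opp k th x : wave (- k) th x = wave k (- th) x.
Proof.
  unfold wave; rewrite opp_IZR, <- cos_neg; f_equal; ring.
Qed.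

Lemma wave_mult_cos k th x x0 :
  cos (x - x0) * wave k th x =
  / 2 * wave (k + 1) (th - x0) x + / 2 * wave (k - 1) (th + x0) x.
Proof.
  unfold wave; rewrite plus_IZR, minus_IZR.
  replace ((IZR k + 1) * x + (th - x0)) with ((IZR k * x + th) + (x - x0)) by ring.
  replace ((IZR k - 1) * x + (th + x0)) with ((IZR k * x + th) - (x - x0)) by ring.
  rewrite (cos_plus _ (x - x0)), (cos_minus _ (x - x0)); field.
Qed.

Lemma fourier_ext (f g : R -> R) k th :
  (forall x, f x = g x) -> fourier f k th = fourier g k th.
Proof. intros E; apply RInt_eq; intros x; now rewrite E. Qed.

Lemma fourier_opp f k th : fourier f (- k) th = fourier f k (- th).
Proof. apply RInt_eq; intros x; now rewrite wave_opp. Qed.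

Lemma fourier_lincomb (f g : R -> R) p q k th :
  (forall x, continuous f x) -> (forall x, continuous g x) ->
  fourier (fun x => p * f x + q * g x) k th = p * fourier f k th + q * fourier g k th.
Proof.
  intros Cf Cg; unfold fourier; rewrite <- RInt_lincomb.
  - apply RInt_eq; intros; ring.
  - intros x; apply continuous_mult_R; auto using wave_continuous.
  - intros x; apply continuous_mult_R; auto using wave_continuous.
Qed.

(** Multiplication by a cosine shifts frequencies by one in both directions.
    This turns a boundary condition with a weight of degree one into a three-term
    recurrence, and lets trigonometric polynomials be tested against a function
    one factor at a time. *)
Lemma fourier_mult_cos (f : R -> R) k th x0 :
  (forall x, continuous f x) ->
  fourier (fun x => cos (x - x0) * f x) k th =
  / 2 * fourier f (k + 1) (th - x0) + / 2 * fourier f (k - 1) (th + x0).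
Proof.
  intros Cf; unfold fourier; rewrite <- RInt_lincomb.
  - apply RInt_eq; intros x.
    transitivity (f x * (cos (x - x0) * wave k th x)); [ring|].
    rewrite wave_mult_cos; ring.
  - intros x; apply continuous_mult_R; auto using wave_continuous.
  - intros x; apply continuous_mult_R; auto using wave_continuous.
Qed.

(** For large n this kernel concentrates at x0, yet it is a trigonometric
    polynomial. *)
Definition peak (x0 : R) (n : nat) (x : R) : R := (1 + cos (x - x0)) ^ n.

Lemma peak_continuous x0 n x : continuous (peak x0 n) x.
Proof.
  unfold peak.
  eapply is_derive_continuous; auto_derive; [exact I | reflexivity].
Qed.

Lemma peak_periodic x0 n x : peak x0 n (x + 2 * PI) = peak x0 n x.
Proof.
  unfold peak; replace (x + 2 * PI - x0) with ((x - x0) + IZR 1 * (2 * PI)) by ring.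
  now rewrite cos_Zperiod.
Qed.

Lemma peak_nonneg x0 n x : 0 <= peak x0 n x.
Proof. apply pow_le; assert (H := COS_bound (x - x0)); lra. Qed.

Lemma RInt_peak_pos x0 n : 0 < RInt (peak x0 n) (x0 - PI) (x0 + PI).
Proof.
  assert (P := PI_RGT_0); apply RInt_gt_0; [lra| |intros; apply peak_continuous].
  intros x Hx; apply pow_lt.
  assert (B := COS_bound (x - x0)).
  destruct (Req_dec (cos (x - x0)) (-1)) as [E|E]; [|lra].
  assert (S : sin (x - x0) = 0).
  { assert (S2 := sin2_cos2 (x - x0)); unfold Rsqr in S2; nra. }
  destruct (Rtotal_order (x - x0) 0) as [L|[L|L]].
  - assert (0 < sin (- (x - x0))) by (apply sin_gt_0; lra).
    rewrite sin_neg in *; lra.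
  - rewrite L, cos_0 in E; lra.
  - assert (0 < sin (x - x0)) by (apply sin_gt_0; lra); lra.
Qed.

(** Concentration of the kernel in exact form: its average of 1 - cos (x - x0) is
    1 / (n + 1).  The derivative of peak x0 n x * sin (x - x0) equals the kernel times
    1 - (n + 1) (1 - cos (x - x0)), and its integral over a period vanishes. *)
Lemma RInt_peak_moment x0 n :
  INR (S n) * RInt (fun x => (1 - cos (x - x0)) * peak x0 n x) (x0 - PI) (x0 + PI)
  = RInt (peak x0 n) (x0 - PI) (x0 + PI).
Proof.
  assert (C : forall x, continuous (fun y => (1 - cos (y - x0)) * peak x0 n y) x).
  { intros x; apply continuous_mult_R; [|apply peak_continuous].
    eapply is_derive_continuous; auto_derive; [exact I | reflexivity]. }
  assert (E := RInt_FTC (fun x => peak x0 n x * sin (x - x0))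
    (fun x => 1 * peak x0 n x + (- INR (S n)) * ((1 - cos (x - x0)) * peak x0 n x))
    (x0 - PI) (x0 + PI)).
  rewrite RInt_lincomb in E by auto using peak_continuous.
  replace (x0 + PI - x0) with PI in E by ring.
  replace (x0 - PI - x0) with (- PI) in E by ring.
  rewrite sin_neg, sin_PI, Ropp_0, !Rmult_0_r, Rminus_0_r in E.
  apply Rminus_diag_uniq_sym.
  rewrite Rmult_1_l, Ropp_mult_distr_l_reverse in E; apply E.
  - intros x; unfold peak; auto_derive; auto.
    assert (S2 : sin (x - x0) * sin (x - x0) = (1 - cos (x - x0)) * (1 + cos (x - x0))).
    { assert (S2 := sin2_cos2 (x - x0)); unfold Rsqr in S2; lra. }
    replace (x + - x0) with (x - x0) by ring.
    destruct n as [|n].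
    + simpl; ring.
    + rewrite <- pred_Sn, (S_INR (S n)).
      transitivity (- INR (S n) * (1 + cos (x - x0)) ^ n * (sin (x - x0) * sin (x - x0))
         + (1 + cos (x - x0)) ^ S n * cos (x - x0)).
      { ring. }
      rewrite S2; simpl ((1 + cos (x - x0)) ^ S n); ring.
  - intros x; apply continuous_plus_R; apply continuous_mult_R;
      auto using peak_continuous; apply continuous_const.
Qed.

Lemma fourier_peak_zero (g : R -> R) x0 n :
  (forall x, continuous g x) -> (forall k th, fourier g k th = 0) ->
  forall k th, fourier (fun x => peak x0 n x * g x) k th = 0.
Proof.
  intros C Z; induction n as [|n IH]; intros k th.
  - transitivity (fourier g k th); auto.
    apply fourier_ext; intros; unfold peak; simpl; ring.
  - assert (Cn : forall x, continuous (fun y => peak x0 n y * g y) x)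
      by (intros; apply continuous_mult_R; auto using peak_continuous).
    rewrite (fourier_ext _ (fun x => 1 * (peak x0 n x * g x)
      + 1 * (cos (x - x0) * (peak x0 n x * g x))))
      by (intros; unfold peak; simpl; ring).
    rewrite fourier_lincomb; auto.
    + rewrite fourier_mult_cos by auto; rewrite !IH; ring.
    + intros x; apply continuous_mult_R; auto.
      eapply is_derive_continuous; auto_derive; [exact I | reflexivity].
Qed.

(** Near x0 continuity keeps g above half its value there; away from x0 the
    quantity 1 - cos (x - x0) is bounded below, so a large K beats the minimum of
    g. *)
Lemma peak_minorant (g : R -> R) x0 : (forall x, continuous g x) -> 0 < g x0 ->
  exists K, forall x, x0 - PI <= x <= x0 + PI ->
    g x0 / 2 - K * (1 - cos (x - x0)) <= g x.
Proof.
  intros C P; assert (PP := PI_RGT_0).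
  destruct (continuity_ab_min g (x0 - PI) (x0 + PI)) as [mx [Hm _]];
    [lra | intros; apply continuity_pt_filterlim; apply C |].
  destruct (proj1 (filterlim_locally g (g x0)) (C x0)
    (mkposreal (g x0 / 2) ltac:(lra))) as [d Hd].
  set (e := Rmin d (PI / 2)).
  assert (He : 0 < e) by (apply Rmin_pos; [apply cond_pos | lra]).
  assert (Hed : e <= d) by apply Rmin_l.
  assert (Hep : e <= PI / 2) by apply Rmin_r.
  assert (Ce : cos e < 1) by (rewrite <- cos_0; apply cos_decreasing_1; lra).
  exists ((g x0 / 2 + Rabs (g mx)) / (1 - cos e)).
  intros x Hx.
  assert (B := COS_bound (x - x0)); assert (A := Rabs_pos (g mx)).
  assert (K0 : 0 < (g x0 / 2 + Rabs (g mx)) / (1 - cos e))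
    by (apply Rdiv_lt_0_compat; lra).
  destruct (Rlt_dec (Rabs (x - x0)) e) as [L|L].
  - assert (H := Hd x); unfold ball in H; simpl in H; unfold AbsRing_ball in H.
    unfold abs, minus, plus, opp in H; simpl in H.
    assert (H' : Rabs (g x + - g x0) < g x0 / 2) by (apply H; unfold Rminus in L; lra).
    apply Rabs_def2 in H'; nra.
  - assert (E : cos (x - x0) = cos (Rabs (x - x0))).
    { unfold Rabs; destruct (Rcase_abs _); [now rewrite cos_neg | reflexivity]. }
    assert (Hpi : Rabs (x - x0) <= PI) by (apply Rabs_le; lra).
    assert (D : cos (Rabs (x - x0)) <= cos e) by (apply cos_decr_1; lra).
    rewrite <- E in D.
    assert (G := Hm x Hx).
    assert (G' := Rle_abs (- g mx)); rewrite Rabs_Ropp in G'.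
    assert (Q : (g x0 / 2 + Rabs (g mx)) / (1 - cos e) * (1 - cos e)
       = g x0 / 2 + Rabs (g mx)) by (field; lra).
    nra.
Qed.

(** If g x0 > 0, integrate the lower bound of [peak_minorant] against the kernel:
    the left side behaves like (g x0 / 2 - K / (n + 1)) times the mass of the
    kernel, while the right side is a combination of vanishing Fourier
    coefficients. *)
Lemma fourier_zero_nonpos (g : R -> R) :
  (forall x, continuous g x) -> (forall x, g (x + 2 * PI) = g x) ->
  (forall k th, fourier g k th = 0) -> forall x0, g x0 <= 0.
Proof.
  intros C P Z x0; apply Rnot_lt_le; intros G.
  destruct (peak_minorant g x0 C G) as [K HK].
  assert (PP := PI_RGT_0).
  destruct (INR_unbounded (K / (g x0 / 2))) as [n Hn].
  set (I := RInt (peak x0 n) (x0 - PI) (x0 + PI)).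
  set (J := RInt (fun x => (1 - cos (x - x0)) * peak x0 n x) (x0 - PI) (x0 + PI)).
  assert (HI : 0 < I) by apply RInt_peak_pos.
  assert (HJ : INR (S n) * J = I) by apply RInt_peak_moment.
  assert (CJ : forall x, continuous (fun x => (1 - cos (x - x0)) * peak x0 n x) x).
  { intros x; apply continuous_mult_R; [|apply peak_continuous].
    eapply is_derive_continuous; auto_derive; [exact Logic.I | reflexivity]. }
  assert (CP : forall x, continuous (fun x => peak x0 n x * g x) x)
    by (intros; apply continuous_mult_R; auto using peak_continuous).
  assert (E0 : RInt (fun x => peak x0 n x * g x) (x0 - PI) (x0 + PI) = 0).
  { replace (x0 + PI) with ((x0 - PI) + 2 * PI) by ring.
    rewrite RInt_period; auto.
    - transitivity (fourier (fun x => peak x0 n x * g x) 0 0);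
        [|now apply fourier_peak_zero].
      apply RInt_eq; intros x.
      unfold wave; rewrite Rmult_0_l, Rplus_0_l, cos_0; ring.
    - intros x; now rewrite peak_periodic, P. }
  assert (E1 : g x0 / 2 * I + (- K) * J <=
     RInt (fun x => peak x0 n x * g x) (x0 - PI) (x0 + PI)).
  { unfold I, J; rewrite <- RInt_lincomb; auto using peak_continuous.
    apply RInt_le; [lra| | |].
    - apply ex_RInt_cont; intros x; apply continuous_plus_R;
        apply continuous_mult_R; auto using peak_continuous; apply continuous_const.
    - apply ex_RInt_cont; auto.
    - intros x Hx; assert (H := HK x ltac:(lra)).
      assert (Q := peak_nonneg x0 n x); nra. }
  rewrite E0, S_INR in *.
  assert (Hn' : K < INR n * (g x0 / 2)).
  { apply Rmult_lt_compat_r with (r := g x0 / 2) in Hn; [|lra].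
    replace (K / (g x0 / 2) * (g x0 / 2)) with K in Hn by (field; lra); lra. }
  assert (P0 := pos_INR n).
  assert (0 < J) by nra.
  nra.
Qed.

Lemma RInt_wave k th : k <> 0%Z -> RInt (wave k th) 0 (2 * PI) = 0.
Proof.
  intros K; assert (K' : IZR k <> 0) by (now apply not_0_IZR).
  rewrite (RInt_FTC (fun x => sin (IZR k * x + th) / IZR k)).
  - replace (IZR k * (2 * PI) + th) with (th + IZR k * (2 * PI)) by ring.
    rewrite sin_Zperiod, Rmult_0_r, Rplus_0_l; apply Rminus_diag.
  - intros x; unfold wave; auto_derive; [exact I | field; exact K'].
  - apply wave_continuous.
Qed.

(** Uniqueness of Fourier coefficients, applied to f minus its mean. *)
Lemma fourier_const_mode (f : R -> R) :
  (forall x, continuous f x) -> (forall x, f (x + 2 * PI) = f x) ->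
  (forall k th, (1 <= k)%Z -> fourier f k th = 0) ->
  forall x, f x = RInt f 0 (2 * PI) / (2 * PI).
Proof.
  intros C P Z; assert (PP := PI_RGT_0).
  set (c := RInt f 0 (2 * PI) / (2 * PI)).
  assert (Hc : forall k th, fourier (fun _ => 1) k th = RInt (wave k th) 0 (2 * PI)).
  { intros; apply RInt_eq; intros; ring. }
  assert (Hz : forall k th, fourier f k th = c * fourier (fun _ => 1) k th).
  { intros k th; rewrite Hc; destruct (Z.eq_dec k 0) as [->|N].
    - unfold c, fourier, wave.
      rewrite (RInt_eq _ (fun x => cos th * f x + 0 * f x))
        by (intros; rewrite Rmult_0_l, Rplus_0_l; ring).
      rewrite RInt_lincomb by auto.
      rewrite (RInt_eq (fun x => cos (0 * x + th)) (fun x => cos th))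
        by (intros; f_equal; ring).
      rewrite RInt_const; unfold scal; simpl; unfold mult; simpl; field; lra.
    - rewrite RInt_wave, Rmult_0_r by auto.
      destruct (Z_lt_le_dec 0 k) as [L|L].
      + apply Z; lia.
      + rewrite <- (Z.opp_involutive k), fourier_opp; apply Z; lia. }
  (* s = 1 and s = -1 give the two inequalities between f and its mean. *)
  assert (H : forall s x, s * f x - s * c <= 0).
  { intros s; apply fourier_zero_nonpos with (g := fun x => s * f x - s * c).
    - intros x; apply continuous_plus_R; [|apply continuous_const].
      apply continuous_mult_R; auto; apply continuous_const.
    - intros x; now rewrite P.
    - intros k th; rewrite (fourier_ext _ (fun x => s * f x + (- s * c) * 1))
        by (intros; ring).
      rewrite (fourier_lincomb f (fun _ => 1)); auto.
      + rewrite Hz; ring.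
      + intros; apply continuous_const. }
  intros x; assert (H1 := H 1 x); assert (H2 := H (-1) x); lra.
Qed.

(** * Fourier coefficients of harmonic functions *)

Lemma fourier_is_derive v k th t : smooth v ->
  is_derive (fun s => fourier (fun x => v x s) k th) t
    (fourier (fun x => dt v x t) k th).
Proof.
  intros S.
  assert (D : forall x s, is_derive (fun z => v x z * wave k th x) s
    (dt v x s * wave k th x)).
  { intros x s; apply is_derive_scal_r; now apply smooth_is_derive_dt. }
  replace (fourier (fun x => dt v x t) k th) with
    (RInt (fun x => Derive (fun s => v x s * wave k th x) t) 0 (2 * PI)).
  - apply (is_derive_RInt_param (fun s x => v x s * wave k th x) 0 (2 * PI) t).
    + apply filter_forall; intros s x _; eexists; apply D.
    + intros x _.
      apply continuity_2d_pt_ext with (fun s z => dt v z s * wave k th z).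
      * intros s z; symmetry; now apply is_derive_unique.
      * apply continuity_2d_pt_mult.
        -- intros eps.
           destruct (smooth_continuity_2d _ x t (smooth_dt v S) eps) as [d Hd].
           exists d; intros s z Hs Hz; now apply Hd.
        -- apply continuity_2d_pt_snd, wave_continuous.
    + apply filter_forall; intros s; apply ex_RInt_cont; intros x.
      apply continuous_mult_R; [|apply wave_continuous].
      now apply (smooth_continuous_x v).
  - apply RInt_eq; intros x; now apply is_derive_unique.
Qed.

(** Two integrations by parts in x, without boundary terms by periodicity. *)
Lemma fourier_harmonic u k th t : smooth u ->
  (forall x, dx (dx u) x t + dt (dt u) x t = 0) ->
  fourier (fun x => dt (dt u) x t) k th = IZR k * IZR k * fourier (fun x => u x t) k th.
Proof.
  intros S H.
  assert (C1 : forall x, continuous (fun y => dx (dx u) y t * wave k th y) x).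
  { intros x; apply continuous_mult_R; [|apply wave_continuous].
    now apply (smooth_continuous_x (dx (dx u))), smooth_dx, smooth_dx. }
  assert (C2 : forall x, continuous (fun y => u y t * wave k th y) x).
  { intros x; apply continuous_mult_R; [|apply wave_continuous].
    now apply (smooth_continuous_x u). }
  assert (E : RInt (fun x => 1 * (dx (dx u) x t * wave k th x)
      + (IZR k * IZR k) * (u x t * wave k th x)) 0 (2 * PI) = 0).
  { rewrite (RInt_FTC (fun x => dx u x t * wave k th x
      + u x t * (IZR k * sin (IZR k * x + th)))).
    - assert (P1 := proj2 (smooth_dx u S) 0 t); assert (P2 := proj2 S 0 t).
      assert (P3 := wave_periodic k th 0).
      rewrite Rplus_0_l in P1, P2, P3; rewrite P1, P2, P3.
      replace (IZR k * (2 * PI) + th) with ((IZR k * 0 + th) + IZR k * (2 * PI)) by ring.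
      rewrite sin_Zperiod; apply Rminus_diag.
    - intros x.
      assert (Dw : is_derive (wave k th) x (- IZR k * sin (IZR k * x + th))).
      { unfold wave; auto_derive; auto; ring. }
      assert (Ds : is_derive (fun y => IZR k * sin (IZR k * y + th)) x
        (IZR k * IZR k * wave k th x)).
      { unfold wave; auto_derive; auto; ring. }
      replace (1 * (dx (dx u) x t * wave k th x) + IZR k * IZR k * (u x t * wave k th x))
        with ((dx (dx u) x t * wave k th x + dx u x t * (- IZR k * sin (IZR k * x + th)))
          + (dx u x t * (IZR k * sin (IZR k * x + th)) + u x t * (IZR k * IZR k * wave k th x)))
        by ring.
      apply (is_derive_plus (fun x => dx u x t * wave k th x)
        (fun x => u x t * (IZR k * sin (IZR k * x + th)))).
      + apply (is_derive_mult (fun z => dx u z t) (wave k th)); auto.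
        * now apply (smooth_is_derive_dx (dx u)), smooth_dx.
        * exact Rmult_comm.
      + apply (is_derive_mult (fun z => u z t) (fun y => IZR k * sin (IZR k * y + th))); auto.
        * now apply (smooth_is_derive_dx u).
        * exact Rmult_comm.
    - intros x; apply continuous_plus_R; apply continuous_mult_R; auto;
        apply continuous_const. }
  rewrite RInt_lincomb in E by auto.
  unfold fourier.
  rewrite (RInt_eq _ (fun x => (-1) * (dx (dx u) x t * wave k th x)
     + 0 * (u x t * wave k th x))).
  - rewrite RInt_lincomb by auto; lra.
  - intros x; assert (Hx := H x).
    replace (dt (dt u) x t) with (- dx (dx u) x t) by lra; ring.
Qed.

(** * Hyperbolic functions *)

Lemma cosh2_sinh2 x : cosh x * cosh x - sinh x * sinh x = 1.
Proof.
  unfold cosh, sinh; assert (E : exp x * exp (- x) = 1)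
    by (rewrite <- exp_plus, Rplus_opp_r; apply exp_0); nra.
Qed.

Lemma cosh_pos x : 0 < cosh x.
Proof. unfold cosh; assert (H := exp_pos x); assert (H' := exp_pos (- x)); lra. Qed.

Lemma sinh_pos x : 0 < x -> 0 < sinh x.
Proof. intros H; rewrite <- sinh_0; now apply sinh_lt. Qed.

Lemma sinh_neg x : sinh (- x) = - sinh x.
Proof. unfold sinh; rewrite Ropp_involutive; lra. Qed.

Lemma cosh_neg x : cosh (- x) = cosh x.
Proof. unfold cosh; rewrite Ropp_involutive; lra. Qed.

Lemma sinh_minus a b : sinh (a - b) = sinh a * cosh b - cosh a * sinh b.
Proof.
  unfold sinh, cosh; replace (- (a - b)) with (- a + b) by ring.
  unfold Rminus; rewrite !exp_plus; field.
Qed.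

Lemma sinh_double a : sinh (2 * a) = 2 * sinh a * cosh a.
Proof.
  replace (2 * a) with (a - - a) by ring.
  rewrite sinh_minus, sinh_neg, cosh_neg; ring.
Qed.

Lemma cosh_double a : cosh (2 * a) = cosh a * cosh a + sinh a * sinh a.
Proof.
  unfold sinh, cosh; replace (2 * a) with (a + a) by ring.
  rewrite Ropp_plus_distr, !exp_plus; field.
Qed.

Lemma sinh_le_mult_cosh x : 0 <= x -> sinh x <= x * cosh x.
Proof.
  intros H.
  assert (D : forall y, is_derive (fun y => y * cosh y - sinh y) y (y * sinh y)).
  { intros y.
    replace (y * sinh y) with ((1 * cosh y + y * sinh y) - cosh y) by ring.
    apply (is_derive_minus (fun y => y * cosh y) sinh); [|apply is_derive_sinh].
    apply (is_derive_mult (fun y => y) cosh).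
    - auto_derive; auto.
    - apply is_derive_cosh.
    - exact Rmult_comm. }
  destruct (MVT_gen (fun y => y * cosh y - sinh y) 0 x (fun y => y * sinh y)) as [c [Hc E]].
  - intros y _; apply D.
  - intros y _; apply continuity_pt_filterlim.
    exact (is_derive_continuous _ y _ (D y)).
  - rewrite Rmin_left, Rmax_right in Hc by lra.
    rewrite sinh_0, Rmult_0_l in E.
    assert (0 <= sinh c).
    { destruct (Req_dec c 0) as [->|N]; [rewrite sinh_0; lra|].
      left; apply sinh_pos; lra. }
    assert (0 <= c * sinh c * (x - 0)) by (apply Rmult_le_pos; [apply Rmult_le_pos|]; lra).
    lra.
Qed.

(** These numbers are the eigenvalues of the map from Neumann to Dirichlet data
    on functions odd in t; that of frequency 0 is T itself, the largest one. *)
Lemma tanh_quotient_bounds k T : k <> 0 -> 0 < T ->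
  0 <= sinh (k * T) / (k * cosh (k * T)) <= T.
Proof.
  assert (W : forall k, 0 < k -> 0 < T -> 0 <= sinh (k * T) / (k * cosh (k * T)) <= T).
  { clear k; intros k K HT; assert (C := cosh_pos (k * T)).
    assert (P : 0 < k * T) by nra.
    assert (S := sinh_pos (k * T) P); assert (L := sinh_le_mult_cosh (k * T) ltac:(lra)).
    assert (Q : 0 < k * cosh (k * T)) by nra.
    split.
    - apply Rlt_le, Rdiv_lt_0_compat; auto.
    - apply Rle_div_l; auto; lra. }
  intros K HT; destruct (Rtotal_order k 0) as [L|[L|L]]; [|lra|auto].
  assert (H := W (- k) ltac:(lra) HT).
  replace (- k * T) with (- (k * T)) in H by ring.
  rewrite sinh_neg, cosh_neg in H.
  assert (C := cosh_pos (k * T)).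
  replace (- sinh (k * T) / (- k * cosh (k * T))) with
    (sinh (k * T) / (k * cosh (k * T))) in H by (field; split; lra); auto.
Qed.

(** The eigenvalues of the map from Neumann to Dirichlet data on functions even
    in t decrease with the frequency, by the subtraction formula for
    sinh (k T - 2 T), and the bound is the value at k = 2. *)
Lemma coth_quotient_bounds k T : 2 <= k -> 0 < T ->
  0 <= cosh (k * T) / (k * sinh (k * T)) <= (1 + tanh T * tanh T) / (4 * tanh T).
Proof.
  intros K HT.
  assert (C := cosh_pos (k * T)).
  assert (S : 0 < sinh (k * T)) by (apply sinh_pos; nra).
  assert (s := sinh_pos T HT); assert (c := cosh_pos T).
  assert (Q : 0 < k * sinh (k * T)) by nra.
  split; [apply Rlt_le, Rdiv_lt_0_compat; auto|].
  assert (D : 0 <= sinh (k * T - 2 * T)).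
  { destruct (Req_dec (k * T - 2 * T) 0) as [->|N]; [rewrite sinh_0; lra|].
    apply Rlt_le, sinh_pos; nra. }
  rewrite sinh_minus, sinh_double, cosh_double in D.
  replace ((1 + tanh T * tanh T) / (4 * tanh T)) with
    ((cosh T * cosh T + sinh T * sinh T) / (4 * sinh T * cosh T))
    by (unfold tanh; field; lra).
  assert (sc : 0 < sinh T * cosh T) by nra.
  apply Rle_div_l; auto.
  replace ((cosh T * cosh T + sinh T * sinh T) / (4 * sinh T * cosh T) * (k * sinh (k * T)))
    with ((cosh T * cosh T + sinh T * sinh T) * (k * sinh (k * T)) / (4 * sinh T * cosh T))
    by (field; lra).
  apply (Rle_div_r (cosh (k * T))); [nra|].
  assert (P : 0 <= sinh (k * T) * (cosh T * cosh T + sinh T * sinh T)) by nra.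
  assert (P' := Rmult_le_pos (k - 2) _ ltac:(lra) P); lra.
Qed.

Lemma tanh_bounds T : 0 < T -> 0 < tanh T < 1.
Proof.
  intros HT; assert (s := sinh_pos T HT); assert (c := cosh_pos T).
  assert (Q := cosh2_sinh2 T); unfold tanh; split.
  - apply Rdiv_lt_0_compat; auto.
  - apply Rlt_div_l; auto; nra.
Qed.

(** * Harmonic functions mode by mode *)

Lemma zero_derivative_const (T : R) (f : R -> R) :
  (forall t, - T <= t <= T -> is_derive f t 0) ->
  forall t, - T <= t <= T -> f t = f 0.
Proof.
  intros D t Ht.
  destruct (MVT_gen f 0 t (fun _ => 0)) as [c [_ E]].
  - intros s Hs; apply D.
    unfold Rmin, Rmax in Hs; destruct (Rle_dec 0 t); lra.
  - intros s Hs; apply continuity_pt_filterlim.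
    apply is_derive_continuous with 0; apply D.
    unfold Rmin, Rmax in Hs; destruct (Rle_dec 0 t); lra.
  - lra.
Qed.

(** The two Wronskians of y with cosh (k t) and sinh (k t) are constant, and y is
    recovered from them because cosh^2 - sinh^2 = 1. *)
Lemma ode_cosh_sinh (T k : R) (y y' y'' : R -> R) : k <> 0 ->
  (forall t, - T <= t <= T -> is_derive y t (y' t)) ->
  (forall t, - T <= t <= T -> is_derive y' t (y'' t)) ->
  (forall t, - T <= t <= T -> y'' t = k * k * y t) ->
  exists a b, forall t, - T <= t <= T ->
    y t = a * cosh (k * t) + b * sinh (k * t) /\
    y' t = k * (a * sinh (k * t) + b * cosh (k * t)).
Proof.
  intros K D1 D2 H.
  assert (Dc : forall t, is_derive (fun s => cosh (k * s)) t (k * sinh (k * t))).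
  { intros t; apply (is_derive_comp cosh (fun s => k * s)); [apply is_derive_cosh|].
    auto_derive; auto; ring. }
  assert (Ds : forall t, is_derive (fun s => sinh (k * s)) t (k * cosh (k * t))).
  { intros t; apply (is_derive_comp sinh (fun s => k * s)); [apply is_derive_sinh|].
    auto_derive; auto; ring. }
  assert (E1 := zero_derivative_const T
    (fun t => y' t * cosh (k * t) - k * (y t * sinh (k * t)))).
  assert (E2 := zero_derivative_const T
    (fun t => y' t * sinh (k * t) - k * (y t * cosh (k * t)))).
  set (w1 := y' 0 * cosh (k * 0) - k * (y 0 * sinh (k * 0))) in E1.
  set (w2 := y' 0 * sinh (k * 0) - k * (y 0 * cosh (k * 0))) in E2.
  exists (- w2 / k), (w1 / k); intros t Ht.
  assert (F1 : y' t * cosh (k * t) - k * (y t * sinh (k * t)) = w1).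
  { apply E1; auto; intros s Hs.
    replace 0 with ((y'' s * cosh (k * s) + y' s * (k * sinh (k * s)))
      - k * (y' s * sinh (k * s) + y s * (k * cosh (k * s))))
      by (rewrite H by auto; ring).
    apply (is_derive_minus (fun t => y' t * cosh (k * t))
      (fun t => k * (y t * sinh (k * t)))).
    - apply (is_derive_mult y' (fun t => cosh (k * t))); auto; exact Rmult_comm.
    - apply (is_derive_scal (fun t => y t * sinh (k * t))).
      apply (is_derive_mult y (fun t => sinh (k * t))); auto; exact Rmult_comm. }
  assert (F2 : y' t * sinh (k * t) - k * (y t * cosh (k * t)) = w2).
  { apply E2; auto; intros s Hs.
    replace 0 with ((y'' s * sinh (k * s) + y' s * (k * cosh (k * s)))
      - k * (y' s * cosh (k * s) + y s * (k * sinh (k * s))))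
      by (rewrite H by auto; ring).
    apply (is_derive_minus (fun t => y' t * sinh (k * t))
      (fun t => k * (y t * cosh (k * t)))).
    - apply (is_derive_mult y' (fun t => sinh (k * t))); auto; exact Rmult_comm.
    - apply (is_derive_scal (fun t => y t * cosh (k * t))).
      apply (is_derive_mult y (fun t => cosh (k * t))); auto; exact Rmult_comm. }
  assert (Q := cosh2_sinh2 (k * t)).
  rewrite <- F1, <- F2; split.
  - transitivity (y t * (cosh (k * t) * cosh (k * t) - sinh (k * t) * sinh (k * t)));
      [rewrite Q; ring | field; auto].
  - transitivity (y' t * (cosh (k * t) * cosh (k * t) - sinh (k * t) * sinh (k * t)));
      [rewrite Q; ring | field; auto].
Qed.

Lemma ode_affine (T : R) (y y' y'' : R -> R) :
  (forall t, - T <= t <= T -> is_derive y t (y' t)) ->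
  (forall t, - T <= t <= T -> is_derive y' t (y'' t)) ->
  (forall t, - T <= t <= T -> y'' t = 0) ->
  forall t, - T <= t <= T -> y t = y 0 + y' 0 * t /\ y' t = y' 0.
Proof.
  intros D1 D2 H.
  assert (E : forall t, - T <= t <= T -> y' t = y' 0).
  { apply zero_derivative_const; intros t Ht; rewrite <- (H t Ht); auto. }
  intros t Ht; split; auto.
  assert (F := zero_derivative_const T (fun s => y s - y' 0 * s)).
  cut (y t - y' 0 * t = y 0 - y' 0 * 0); [lra|].
  apply F; auto; intros s Hs.
  replace 0 with (y' s - y' 0) at 1 by (rewrite E by auto; ring).
  apply (is_derive_minus y (fun s => y' 0 * s)); auto.
  auto_derive; auto; ring.
Qed.

Definition mode (u : R -> R -> R) (k : Z) (th t : R) : R :=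
  fourier (fun x => u x t) k th.

Definition harmonic (T : R) (u : R -> R -> R) : Prop :=
  forall x t, in_cylinder T t -> dx (dx u) x t + dt (dt u) x t = 0.

Lemma mode_cosh_sinh T u k th : smooth u -> harmonic T u -> k <> 0%Z ->
  exists a b, forall t, in_cylinder T t ->
    mode u k th t = a * cosh (IZR k * t) + b * sinh (IZR k * t) /\
    mode (dt u) k th t = IZR k * (a * sinh (IZR k * t) + b * cosh (IZR k * t)).
Proof.
  intros S H K.
  apply (ode_cosh_sinh T (IZR k) (mode u k th) (mode (dt u) k th) (mode (dt (dt u)) k th)).
  - now apply not_0_IZR.
  - intros t _; now apply fourier_is_derive.
  - intros t _; now apply fourier_is_derive, smooth_dt.
  - intros t Ht; apply fourier_harmonic; auto.
Qed.

Lemma mode_affine T u th : smooth u -> harmonic T u ->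
  forall t, in_cylinder T t ->
    mode u 0 th t = mode u 0 th 0 + mode (dt u) 0 th 0 * t /\
    mode (dt u) 0 th t = mode (dt u) 0 th 0.
Proof.
  intros S H.
  apply (ode_affine T (mode u 0 th) (mode (dt u) 0 th) (mode (dt (dt u)) 0 th)).
  - intros t _; now apply fourier_is_derive.
  - intros t _; now apply fourier_is_derive, smooth_dt.
  - intros t Ht; unfold mode; rewrite fourier_harmonic; auto; ring.
Qed.

Lemma fourier_bounded (f : R -> R) : (forall x, continuous f x) ->
  exists B, forall k th, Rabs (fourier f k th) <= B.
Proof.
  intros C; assert (PP := PI_RGT_0).
  assert (CA : forall g : R -> R, (forall x, continuous g x) ->
    forall x, continuous (fun y => Rabs (g y)) x).
  { intros g Cg x; apply (continuous_comp g Rabs); auto.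
    apply continuity_pt_filterlim, Rcontinuity_abs. }
  assert (CW : forall k th x, continuous (fun y => f y * wave k th y) x)
    by (intros; apply continuous_mult_R; auto using wave_continuous).
  exists (RInt (fun x => Rabs (f x)) 0 (2 * PI)); intros k th.
  apply Rle_trans with (RInt (fun x => Rabs (f x * wave k th x)) 0 (2 * PI)).
  - apply abs_RInt_le; [lra|]; apply ex_RInt_cont, CW.
  - apply RInt_le; [lra | apply ex_RInt_cont, CA, CW | apply ex_RInt_cont, CA, C |].
    intros x _; rewrite Rabs_mult.
    apply Rle_trans with (Rabs (f x) * 1); [|lra].
    apply Rmult_le_compat_l; [apply Rabs_pos|].
    apply Rabs_le, COS_bound.
Qed.

(** The boundary condition for the Poisson weight, read off on Fourier
    coefficients. *)
Lemma weighted_recurrence (r sigma : R) (f g : R -> R) k th :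
  (forall x, continuous f x) -> (forall x, continuous g x) ->
  (forall x, (1 + r * r - 2 * r * cos x) * g x = sigma * f x) ->
  (1 + r * r) * fourier g k th - r * (fourier g (k + 1) th + fourier g (k - 1) th)
    = sigma * fourier f k th.
Proof.
  intros Cf Cg H.
  assert (Cc : forall x, continuous (fun y => cos (y - 0) * g y) x).
  { intros x; apply continuous_mult_R; auto.
    eapply is_derive_continuous; auto_derive; [exact I | reflexivity]. }
  transitivity (fourier (fun x => sigma * f x + 0 * f x) k th).
  - rewrite (fourier_ext (fun x => sigma * f x + 0 * f x)
      (fun x => (1 + r * r) * g x + (- 2 * r) * (cos (x - 0) * g x))).
    + rewrite fourier_lincomb, fourier_mult_cos by auto.
      rewrite Rminus_0_r, Rplus_0_r; field.
    + intros x; rewrite Rmult_0_l, Rplus_0_r, <- H, Rminus_0_r; ring.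
  - rewrite fourier_lincomb by auto; ring.
Qed.

(** * Bounded solutions of three-term recurrences *)

Lemma bounded_sup {I : Type} (i0 : I) (b : I -> R) (B : R) :
  (forall i, Rabs (b i) <= B) ->
  exists M, 0 <= M /\ (forall i, Rabs (b i) <= M) /\
    forall M', (forall i, Rabs (b i) <= M') -> M <= M'.
Proof.
  intros H.
  destruct (completeness (fun y => exists i, y = Rabs (b i))) as [M [U L]].
  - exists B; intros y [i ->]; auto.
  - exists (Rabs (b i0)); now exists i0.
  - assert (U' : forall i, Rabs (b i) <= M) by (intros i; apply U; now exists i).
    exists M; repeat split; auto.
    + apply Rle_trans with (1 := Rabs_pos (b i0)); auto.
    + intros M' H'; apply L; intros y [i ->]; auto.
Qed.

(** At an index where |b k| is close to its supremum M the inequality gives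
    d M <= 2 r M. *)
Lemma recurrence_full_zero (b : Z -> R) (r d B : R) :
  0 <= r -> 2 * r < d -> (forall k, Rabs (b k) <= B) ->
  (forall k, d * Rabs (b k) <= r * (Rabs (b (k + 1)%Z) + Rabs (b (k - 1)%Z))) ->
  forall k, b k = 0.
Proof.
  intros Hr Hd HB H.
  destruct (bounded_sup 0%Z b B HB) as (M & M0 & U & L).
  assert (HM : M <= 2 * r * M / d).
  { apply L; intros k; apply Rle_div_r; [lra|].
    assert (A := H k); assert (A1 := U (k + 1)%Z); assert (A2 := U (k - 1)%Z).
    nra. }
  assert (M <= 0).
  { apply Rle_div_r in HM; [|lra]. nra. }
  intros k; apply Rabs_eq_0; assert (A := U k); assert (A0 := Rabs_pos (b k)); lra.
Qed.

(** The supremum M over the indices n >= 2 satisfies d M <= r (|b 1| + M) unless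
    |b 1| <= M, in which case already d M <= 2 r M.  Inserting
    M <= r |b 1| / (d - r) into q 1 * b 1 = r * b 2 contradicts the assumption on
    q 1 unless b 1 = 0. *)
Lemma recurrence_half_zero (b q : nat -> R) (r d B : R) :
  0 < r -> 2 * r < d -> (forall n, Rabs (b n) <= B) ->
  b 0%nat = 0 ->
  r * r < q 1%nat * (d - r) ->
  (forall n, (2 <= n)%nat -> d <= q n) ->
  (forall n, q (S n) * b (S n) = r * (b (S (S n)) + b n)) ->
  forall n, b n = 0.
Proof.
  intros Hr Hd HB H0 H1 H2 H.
  destruct (bounded_sup 0%nat (fun n => b (S (S n))) B (fun n => HB _)) as (M & M0 & U & L).
  assert (T2 : forall n, d * Rabs (b (S (S n))) <=
    r * (Rabs (b (S (S (S n)))) + Rabs (b (S n)))).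
  { intros n; apply Rle_trans with (Rabs (q (S (S n)) * b (S (S n)))).
    - rewrite Rabs_mult; apply Rmult_le_compat_r; [apply Rabs_pos|].
      apply Rle_trans with (2 := Rle_abs _); apply H2; lia.
    - rewrite H, Rabs_mult, (Rabs_right r) by lra.
      apply Rmult_le_compat_l; [lra | apply Rabs_triang]. }
  assert (Q1 : 0 < q 1%nat) by nra.
  assert (T1 : q 1%nat * Rabs (b 1%nat) <= r * M).
  { replace (q 1%nat * Rabs (b 1%nat)) with (Rabs (q 1%nat * b 1%nat))
      by (rewrite Rabs_mult, (Rabs_right (q 1%nat)); lra).
    rewrite H, H0, Rplus_0_r, Rabs_mult, (Rabs_right r) by lra.
    apply Rmult_le_compat_l; [lra | apply (U 0%nat)]. }
  assert (P1 := Rabs_pos (b 1%nat)).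
  assert (N : forall n, Rabs (b (S n)) <= Rmax (Rabs (b 1%nat)) M).
  { intros [|n]; [apply Rmax_l|].
    apply Rle_trans with (1 := U n); apply Rmax_r. }
  assert (HM : M <= r * (M + Rmax (Rabs (b 1%nat)) M) / d).
  { apply L; intros n; apply Rle_div_r; [lra|].
    assert (A := T2 n); assert (A1 := U (S n)); assert (A2 := N n).
    nra. }
  apply Rle_div_r in HM; [|lra].
  assert (Z : M = 0 /\ Rabs (b 1%nat) = 0).
  { destruct (Rle_dec (Rabs (b 1%nat)) M) as [C|C].
    - rewrite Rmax_right in HM by lra.
      assert (M = 0) by nra; split; lra.
    - rewrite Rmax_left in HM by lra.
      assert (M * (d - r) <= r * Rabs (b 1%nat)) by lra.
      assert (q 1%nat * Rabs (b 1%nat) * (d - r) <= r * M * (d - r))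
        by (apply Rmult_le_compat_r; lra).
      nra. }
  destruct Z as [ZM Z1].
  intros [|n]; auto.
  apply Rabs_eq_0; assert (A := N n); rewrite ZM, Z1, Rmax_left in A by lra.
  assert (A0 := Rabs_pos (b (S n))); lra.
Qed.

(** * Eigenfunctions for the Poisson weight *)

Lemma in_cylinder_top T : 0 < T -> in_cylinder T T.
Proof. unfold in_cylinder; lra. Qed.

Lemma in_cylinder_bottom T : 0 < T -> in_cylinder T (- T).
Proof. unfold in_cylinder; lra. Qed.

Section rigidity.
Variables (T r sigma : R) (u : R -> R -> R).
Hypothesis HT : 0 < T.
Hypothesis Hr : 0 < r.
Hypothesis Hr_even : 8 * r <= 1 - tanh T * tanh T.
Hypothesis Hr_odd : 4 * r <= 1 - tanh T * T.
Hypothesis Hsigma : sigma <= tanh T * (1 - r * r + r * r * r).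
Hypothesis Su : smooth u.
Hypothesis Hu : harmonic T u.
Hypothesis Bu_top :
  forall x, (1 + r * r - 2 * r * cos x) * dt u x T = sigma * u x T.
Hypothesis Bu_bot :
  forall x, (1 + r * r - 2 * r * cos x) * dt u x (- T) = - sigma * u x (- T).

Lemma mode_recurrence_top k th :
  (1 + r * r) * mode (dt u) k th T
    - r * (mode (dt u) (k + 1) th T + mode (dt u) (k - 1) th T)
  = sigma * mode u k th T.
Proof.
  apply weighted_recurrence; auto; intros x; apply smooth_continuous_x with (t := T);
    auto using smooth_dt.
Qed.

Lemma mode_recurrence_bot k th :
  (1 + r * r) * mode (dt u) k th (- T)
    - r * (mode (dt u) (k + 1) th (- T) + mode (dt u) (k - 1) th (- T))
  = - sigma * mode u k th (- T).
Proof.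
  apply weighted_recurrence; auto; intros x; apply smooth_continuous_x with (t := - T);
    auto using smooth_dt.
Qed.

Lemma mode_bounded : exists B, forall k th,
  Rabs (mode (dt u) k th T) <= B /\ Rabs (mode (dt u) k th (- T)) <= B.
Proof.
  destruct (fourier_bounded (fun x => dt u x T)) as [B1 H1].
  { intros x; now apply (smooth_continuous_x (dt u)), smooth_dt. }
  destruct (fourier_bounded (fun x => dt u x (- T))) as [B2 H2].
  { intros x; now apply (smooth_continuous_x (dt u)), smooth_dt. }
  exists (Rmax B1 B2); intros k th; split; unfold mode.
  - apply Rle_trans with (1 := H1 k th), Rmax_l.
  - apply Rle_trans with (1 := H2 k th), Rmax_r.
Qed.

Lemma sigma_le : sigma <= tanh T.
Proof.
  assert (L := tanh_bounds T HT).
  apply Rle_trans with (1 := Hsigma); rewrite <- (Rmult_1_r (tanh T)) at 2.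
  apply Rmult_le_compat_l; [lra|].
  assert (r <= 1) by nra; nra.
Qed.

(** On the part of u odd in t the Dirichlet data are nu times the Neumann data
    with 0 <= nu <= T, so the coefficient 1 + r^2 - sigma nu of the recurrence is
    at least 1 - T tanh T.  This is where T < T1 enters. *)
Lemma odd_flux_zero k th : mode (dt u) k th T + mode (dt u) k th (- T) = 0.
Proof.
  assert (L := tanh_bounds T HT); assert (SL := sigma_le).
  destruct mode_bounded as [B HB].
  apply (recurrence_full_zero
    (fun k => mode (dt u) k th T + mode (dt u) k th (- T)) r (1 - tanh T * T) (2 * B));
    [lra | lra | |]; clear k; intros k.
  - apply Rle_trans with (1 := Rabs_triang _ _).
    destruct (HB k th); lra.
  - set (b := fun k => mode (dt u) k th T + mode (dt u) k th (- T)).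
    change (mode (dt u) k th T + mode (dt u) k th (- T)) with (b k).
    change (mode (dt u) (k + 1) th T + mode (dt u) (k + 1) th (- T)) with (b (k + 1)%Z).
    change (mode (dt u) (k - 1) th T + mode (dt u) (k - 1) th (- T)) with (b (k - 1)%Z).
    assert (E : exists nu, 0 <= nu <= T /\
      mode u k th T - mode u k th (- T) = nu * b k).
    { destruct (Z.eq_dec k 0) as [->|K].
      - exists T; split; [lra|]; unfold b.
        destruct (mode_affine T u th Su Hu T (in_cylinder_top T HT)) as [-> ->].
        destruct (mode_affine T u th Su Hu (- T) (in_cylinder_bottom T HT)) as [-> ->]; ring.
      - assert (K' : IZR k <> 0) by (now apply not_0_IZR).
        exists (sinh (IZR k * T) / (IZR k * cosh (IZR k * T))).
        split; [now apply tanh_quotient_bounds|]; unfold b.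
        destruct (mode_cosh_sinh T u k th Su Hu K) as (p & q & H).
        destruct (H T (in_cylinder_top T HT)) as [-> ->].
        destruct (H (- T) (in_cylinder_bottom T HT)) as [-> ->].
        replace (IZR k * - T) with (- (IZR k * T)) by ring.
        rewrite sinh_neg, cosh_neg; assert (C := cosh_pos (IZR k * T)).
        field; split; lra. }
    destruct E as (nu & Hnu & E).
    assert (Q : (1 + r * r - sigma * nu) * b k = r * (b (k + 1)%Z + b (k - 1)%Z)).
    { assert (H1 := mode_recurrence_top k th); assert (H2 := mode_recurrence_bot k th).
      unfold b in *; nra. }
    apply Rle_trans with (Rabs ((1 + r * r - sigma * nu) * b k)).
    + rewrite Rabs_mult; apply Rmult_le_compat_r; [apply Rabs_pos|].
      apply Rle_trans with (2 := Rle_abs _).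
      assert (sigma * nu <= tanh T * nu) by (apply Rmult_le_compat_r; lra).
      assert (tanh T * nu <= tanh T * T) by (apply Rmult_le_compat_l; lra).
      nra.
    + rewrite Q, Rabs_mult, (Rabs_right r) by lra.
      apply Rmult_le_compat_l; [lra | apply Rabs_triang].
Qed.

Lemma even_mode_relation (n : nat) th :
  mode u (Z.of_nat (S n)) th T + mode u (Z.of_nat (S n)) th (- T) =
  cosh (INR (S n) * T) / (INR (S n) * sinh (INR (S n) * T)) *
  (mode (dt u) (Z.of_nat (S n)) th T - mode (dt u) (Z.of_nat (S n)) th (- T)).
Proof.
  assert (K' : 0 < INR (S n)) by (apply lt_0_INR; lia).
  destruct (mode_cosh_sinh T u (Z.of_nat (S n)) th Su Hu ltac:(lia)) as (p & q & H).
  destruct (H T (in_cylinder_top T HT)) as [-> ->].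
  destruct (H (- T) (in_cylinder_bottom T HT)) as [-> ->].
  rewrite <- INR_IZR_INZ.
  replace (INR (S n) * - T) with (- (INR (S n) * T)) by ring.
  rewrite sinh_neg, cosh_neg.
  assert (C : 0 < sinh (INR (S n) * T)) by (apply sinh_pos; nra).
  field; split; lra.
Qed.

(** Frequency 0 carries no flux, since an even affine function of t is constant.
    This decouples the positive frequencies from the negative ones and makes the
    half-line recurrence, with its sharp condition at n = 1, available. *)
Lemma even_flux_zero (n : nat) th :
  mode (dt u) (Z.of_nat n) th T - mode (dt u) (Z.of_nat n) th (- T) = 0.
Proof.
  assert (L := tanh_bounds T HT); assert (SL := sigma_le).
  set (l := tanh T) in *.
  destruct mode_bounded as [B HB].
  set (nu := fun n => cosh (INR n * T) / (INR n * sinh (INR n * T))).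
  assert (N1 : nu 1%nat = / l).
  { unfold nu, l, tanh; rewrite Rmult_1_l.
    assert (s := sinh_pos T HT); assert (c := cosh_pos T); simpl; field; lra. }
  revert n; apply (recurrence_half_zero
    (fun n => mode (dt u) (Z.of_nat n) th T - mode (dt u) (Z.of_nat n) th (- T))
    (fun n => 1 + r * r - sigma * nu n) r ((3 - l * l) / 4) (2 * B)).
  - lra.
  - nra.
  - intros n; apply Rle_trans with (1 := Rabs_triang _ _); rewrite Rabs_Ropp.
    destruct (HB (Z.of_nat n) th); lra.
  - destruct (mode_affine T u th Su Hu T (in_cylinder_top T HT)) as [_ E1].
    destruct (mode_affine T u th Su Hu (- T) (in_cylinder_bottom T HT)) as [_ E2].
    simpl; rewrite E1, E2; ring.
  - rewrite N1.
    assert (E : sigma * / l <= 1 - r * r + r * r * r) by (apply Rle_div_l; lra).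
    (* q 1 is at least r^2 (2 - r) and d - r is at least 1/2 + r. *)
    apply Rlt_le_trans with (r * r * (2 - r) * (1 / 2 + r)).
    + assert (0 < r * r) by nra; nra.
    + apply Rmult_le_compat; nra.
  - intros n Hn.
    assert (H2 : 2 <= INR n) by (apply (le_INR 2 n Hn)).
    destruct (coth_quotient_bounds (INR n) T H2 HT) as [A1 A2].
    fold l (nu n) in A1, A2.
    assert (A3 : sigma * nu n <= l * nu n) by (apply Rmult_le_compat_r; lra).
    assert (A4 : l * nu n <= l * ((1 + l * l) / (4 * l))) by (apply Rmult_le_compat_l; lra).
    replace (l * ((1 + l * l) / (4 * l))) with ((1 + l * l) / 4) in A4 by (field; lra).
    nra.
  - intros n.
    assert (H1 := mode_recurrence_top (Z.of_nat (S n)) th).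
    assert (H2 := mode_recurrence_bot (Z.of_nat (S n)) th).
    assert (H3 := even_mode_relation n th); fold (nu (S n)) in H3.
    replace (Z.of_nat (S n) + 1)%Z with (Z.of_nat (S (S n))) in * by lia.
    replace (Z.of_nat (S n) - 1)%Z with (Z.of_nat n) in * by lia.
    nra.
Qed.

(** Once all Neumann data vanish, every nonzero frequency of u vanishes on the
    whole cylinder and the zero frequency does not depend on t. *)
Lemma poisson_weight_rigidity :
  forall x t, in_cylinder T t -> u x t = mode u 0 0 0 / (2 * PI).
Proof.
  assert (Z1 : forall k th t, (1 <= k)%Z -> in_cylinder T t -> mode u k th t = 0).
  { intros k th t K Ht.
    assert (HE := even_flux_zero (Z.to_nat k) th); rewrite Z2Nat.id in HE by lia.
    assert (HO := odd_flux_zero k th).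
    assert (K' : 1 <= IZR k) by (now apply IZR_le).
    destruct (mode_cosh_sinh T u k th Su Hu ltac:(lia)) as (p & q & H).
    destruct (H T (in_cylinder_top T HT)) as [_ E1].
    destruct (H (- T) (in_cylinder_bottom T HT)) as [_ E2].
    rewrite E1, E2 in HE, HO.
    replace (IZR k * - T) with (- (IZR k * T)) in * by ring.
    rewrite sinh_neg, cosh_neg in *.
    assert (C : 0 < cosh (IZR k * T)) by apply cosh_pos.
    assert (S : 0 < sinh (IZR k * T)) by (apply sinh_pos; nra).
    assert (P0 : p = 0).
    { apply Rmult_eq_reg_r with (2 * IZR k * sinh (IZR k * T)); nra. }
    assert (Q0 : q = 0).
    { apply Rmult_eq_reg_r with (2 * IZR k * cosh (IZR k * T)); nra. }
    destruct (H t Ht) as [-> _]; rewrite P0, Q0; ring. }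
  intros x t Ht.
  rewrite (fourier_const_mode (fun x => u x t)).
  - f_equal; transitivity (mode u 0 0 t).
    + apply RInt_eq; intros y; unfold wave.
      rewrite Rmult_0_l, Rplus_0_l, cos_0; symmetry; apply Rmult_1_r.
    + assert (HO := odd_flux_zero 0 0).
      destruct (mode_affine T u 0 Su Hu t Ht) as [-> _].
      destruct (mode_affine T u 0 Su Hu T (in_cylinder_top T HT)) as [_ E1].
      destruct (mode_affine T u 0 Su Hu (- T) (in_cylinder_bottom T HT)) as [_ E2].
      rewrite E1, E2 in HO.
      replace (mode (dt u) 0 0 0) with 0 by lra; rewrite Rmult_0_l; apply Rplus_0_r.
  - intros y; now apply (smooth_continuous_x u).
  - intros y; apply (proj2 Su).
  - intros k th K; now apply (Z1 k th t).
Qed.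
End rigidity.

(** * The Steklov problem of a conformal metric *)

(** The interval contains points arbitrarily close to t on at least one side, so
    it determines the derivative.  This is needed at the ends t = T and t = -T,
    where a metric and its determinant are only controlled from inside. *)
Lemma Derive_agree_cylinder (T t l : R) (f g : R -> R) :
  0 < T -> in_cylinder T t -> (forall s, in_cylinder T s -> f s = g s) ->
  ex_derive f t -> is_derive g t l -> Derive f t = l.
Proof.
  intros HT Ht E [m Df] Dg.
  rewrite (is_derive_unique f t m Df).
  assert (D : derivable_pt_lim (fun s => f s - g s) t (m - l)).
  { apply is_derive_Reals; now apply (is_derive_minus f g). }
  apply Rminus_diag_uniq; apply cond_eq; intros eps Heps.
  rewrite Rminus_0_r; destruct (D eps Heps) as [d Hd].
  assert (P := cond_pos d).
  set (e := Rmin (d / 2) T).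
  assert (He : 0 < e) by (apply Rmin_pos; lra).
  assert (Hed : e <= d / 2) by apply Rmin_l.
  assert (HeT : e <= T) by apply Rmin_r.
  unfold in_cylinder in *.
  (* Step towards the middle of the cylinder, so that both points stay in it. *)
  assert (X : exists h, h <> 0 /\ Rabs h < d /\ - T <= t + h <= T).
  { destruct (Rle_dec t 0).
    - exists e; repeat split; try lra; rewrite Rabs_right; lra.
    - exists (- e); repeat split; try lra; rewrite Rabs_left; lra. }
  destruct X as (h & Nh & Ah & Ih).
  assert (B := Hd h Nh Ah); rewrite (E (t + h)), (E t) in B by auto.
  replace ((g (t + h) - g (t + h) - (g t - g t)) / h - (m - l)) with (- (m - l)) in B
    by (field; auto).
  now rewrite Rabs_Ropp in B.
Qed.

Lemma conformal_components T (h : metric T) x t :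
  conformal_class (flat_metric T) h -> in_cylinder T t ->
  0 < g11 h x t /\ g12 h x t = 0 /\ g22 h x t = g11 h x t.
Proof.
  intros [w [_ H]] Ht; destruct (H x t Ht) as (E1 & E2 & E3); simpl in *.
  rewrite E1, E2, E3; assert (P := exp_pos (2 * w x t)); repeat split; lra.
Qed.

Lemma conformal_gdet T (h : metric T) x t :
  conformal_class (flat_metric T) h -> in_cylinder T t ->
  gdet h x t = g11 h x t * g11 h x t.
Proof.
  intros C Ht; destruct (conformal_components T h x t C Ht) as (_ & E2 & E3).
  unfold gdet; rewrite E2, E3; ring.
Qed.

(** Conformal invariance in dimension two: the volume density cancels the factor
    of the inverse metric. *)
Lemma conformal_flux T (h : metric T) u x t :
  conformal_class (flat_metric T) h -> in_cylinder T t ->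
  sqrt (gdet h x t) * grad1 h u x t = dx u x t /\
  sqrt (gdet h x t) * grad2 h u x t = dt u x t.
Proof.
  intros C Ht; unfold grad1, grad2; rewrite (conformal_gdet T h x t C Ht).
  destruct (conformal_components T h x t C Ht) as (P & E2 & E3).
  rewrite E2, E3, sqrt_square by lra; split; field; lra.
Qed.

Lemma laplacian_conformal T (h : metric T) u x t :
  0 < T -> conformal_class (flat_metric T) h -> smooth u -> in_cylinder T t ->
  laplacian h u x t = (dx (dx u) x t + dt (dt u) x t) / g11 h x t.
Proof.
  intros HT C S Ht; unfold laplacian.
  destruct (conformal_components T h x t C Ht) as (P & E2 & E3).
  assert (G := conformal_gdet T h x t C Ht).
  assert (E1 : sqrt (gdet h x t) = g11 h x t) by (rewrite G; apply sqrt_square; lra).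
  rewrite E1; f_equal; f_equal.
  - unfold dx at 1; apply Derive_ext; intros y; now apply conformal_flux.
  - unfold dt at 1.
    apply Derive_agree_cylinder with (T := T) (g := fun s => dt u x s); auto.
    + intros s Hs; now apply conformal_flux.
    + assert (D11 := smooth_is_derive_dt (g11 h) x t (g11_smooth T h)).
      assert (D12 := smooth_is_derive_dt (g12 h) x t (g12_smooth T h)).
      assert (D22 := smooth_is_derive_dt (g22 h) x t (g22_smooth T h)).
      assert (Dx := smooth_is_derive_dt (dx u) x t (smooth_dx u S)).
      assert (Dt := smooth_is_derive_dt (dt u) x t (smooth_dt u S)).
      assert (GP : 0 < gdet h x t) by (rewrite G; nra).
      unfold grad2, gdet in *.
      revert D11 D12 D22 Dx Dt GP.
      generalize (dx u x) (dt u x) (g11 h x) (g12 h x) (g22 h x)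
        (dt (dx u) x t) (dt (dt u) x t) (dt (g11 h) x t) (dt (g12 h) x t) (dt (g22 h) x t).
      intros p q a b c p' q' a' b' c' D11 D12 D22 Dx Dt GP.
      auto_derive; repeat split; auto;
        try (eexists; eassumption); unfold Rminus in *; lra.
    + now apply (smooth_is_derive_dt (dt u)), smooth_dt.
Qed.

(** At an end of the cylinder the unit normal is d/dt divided by the boundary
    length density, up to sign, which is how the weight enters. *)
Lemma steklov_conformal_iff T (h : metric T) sigma u :
  0 < T -> conformal_class (flat_metric T) h ->
  steklov_eigenfunction h sigma u <->
  smooth u /\ (exists x t, in_cylinder T t /\ u x t <> 0) /\ harmonic T u /\
  (forall x, dt u x T = sigma * sqrt (g11 h x T) * u x T) /\
  (forall x, - dt u x (- T) = sigma * sqrt (g11 h x (- T)) * u x (- T)).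
Proof.
  intros HT C.
  assert (TI := in_cylinder_top T HT).
  assert (BI := in_cylinder_bottom T HT).
  assert (SP : forall x t, in_cylinder T t -> 0 < sqrt (g11 h x t) /\
     sqrt (g11 h x t) * sqrt (g11 h x t) = g11 h x t).
  { intros x t Ht; destruct (conformal_components T h x t C Ht) as (P & _).
    split; [now apply sqrt_lt_R0 | apply sqrt_sqrt; lra]. }
  assert (SQ : forall y, 0 < y -> y * y = 1 -> y = 1) by (intros; nra).
  assert (NI : forall x t a b, in_cylinder T t ->
     inner h x t a b 1 0 = 0 /\ inner h x t a b a b = 1 <->
     a = 0 /\ (sqrt (g11 h x t) * b) * (sqrt (g11 h x t) * b) = 1).
  { intros x t a b Ht; destruct (conformal_components T h x t C Ht) as (P & E2 & E3).
    destruct (SP x t Ht) as [P' E].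
    unfold inner; rewrite E2, E3.
    replace (sqrt (g11 h x t) * b * (sqrt (g11 h x t) * b)) with (g11 h x t * (b * b))
      by (rewrite <- E at 1; ring).
    split.
    - intros [A B]; assert (a = 0) by nra; subst; split; lra.
    - intros [-> B]; split; lra. }
  split.
  - intros (S & N & L & Bd); repeat split; auto; try apply S.
    + intros x t Ht; assert (E := L x t Ht).
      rewrite laplacian_conformal in E by auto.
      destruct (conformal_components T h x t C Ht) as (P & _).
      apply Rmult_eq_reg_r with (/ g11 h x t); [|apply Rinv_neq_0_compat; lra].
      rewrite Rmult_0_l; exact E.
    + intros x; destruct (SP x T TI) as [P _].
      destruct (NI x T 0 (/ sqrt (g11 h x T)) TI) as [_ I].
      destruct I as [I1 I2]; [split; auto; field; lra|].
      assert (IP := Rinv_0_lt_compat _ P).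
      assert (E : 0 * dx u x T + / sqrt (g11 h x T) * dt u x T = sigma * u x T).
      { apply Bd; repeat split; auto. }
      apply Rmult_eq_reg_l with (/ sqrt (g11 h x T)); [|apply Rinv_neq_0_compat; lra].
      transitivity (sigma * u x T); [lra | field; lra].
    + intros x; destruct (SP x (- T) BI) as [P _].
      destruct (NI x (- T) 0 (- / sqrt (g11 h x (- T))) BI) as [_ I].
      destruct I as [I1 I2]; [split; auto; field; lra|].
      assert (IP := Rinv_0_lt_compat _ P).
      assert (E : 0 * dx u x (- T) + - / sqrt (g11 h x (- T)) * dt u x (- T)
        = sigma * u x (- T)).
      { apply Bd; repeat split; auto; right; split; auto; lra. }
      apply Rmult_eq_reg_l with (/ sqrt (g11 h x (- T))); [|lra].
      transitivity (sigma * u x (- T)); [lra | field; lra].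
  - intros (S & N & H & B1 & B2); split; [auto|]; split; [auto|]; split.
    + intros x t Ht; rewrite laplacian_conformal by auto.
      rewrite H by auto; unfold Rdiv; ring.
    + intros x t a b (I1 & I2 & [[-> Sg]|[-> Sg]]).
      * destruct (NI x T a b TI) as [I _]; destruct I as [-> E]; [auto|].
        destruct (SP x T TI) as [P _].
        assert (E' : sqrt (g11 h x T) * b = 1) by (apply SQ; [nra | exact E]).
        rewrite B1, <- (Rmult_1_l (sigma * u x T)), <- E'; ring.
      * destruct (NI x (- T) a b BI) as [I _]; destruct I as [-> E]; [auto|].
        destruct (SP x (- T) BI) as [P _].
        assert (E' : sqrt (g11 h x (- T)) * (- b) = 1) by (apply SQ; [nra | lra]).
        rewrite <- (Rmult_1_l (sigma * u x (- T))), <- E'.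
        transitivity (- b * - dt u x (- T)); [ring|]; rewrite B2; ring.
Qed.

(** * Rotationally symmetric metrics *)

Lemma dx_separated F F' G x t : is_derive F x F' ->
  dx (fun y s => F y * G s) x t = F' * G t.
Proof. intros D; apply is_derive_unique; now apply is_derive_scal_r. Qed.

Lemma dt_separated F G G' x t : is_derive G t G' ->
  dt (fun y s => F y * G s) x t = F x * G'.
Proof. intros D; apply is_derive_unique; now apply (is_derive_scal G). Qed.

Lemma smooth_cos_coshsinh A B :
  smooth (fun x t => cos x * (A * cosh t + B * sinh t)).
Proof.
  apply (smooth_separated cos (fun t => A * cosh t + B * sinh t)).
  - intros n; apply Cn_ext with (fun x => 1 * cos x + 0 * sin x).
    + intros; ring.
    + apply Cinf_sincos.
  - apply Cinf_coshsinh.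
  - intros x; replace (x + 2 * PI) with (x + IZR 1 * (2 * PI)) by ring.
    apply cos_Zperiod.
Qed.

Lemma dt_cos_coshsinh A B x t :
  dt (fun x t => cos x * (A * cosh t + B * sinh t)) x t =
  cos x * (B * cosh t + A * sinh t).
Proof.
  apply (dt_separated cos (fun t => A * cosh t + B * sinh t)), is_derive_coshsinh.
Qed.

Lemma harmonic_cos_coshsinh T A B :
  harmonic T (fun x t => cos x * (A * cosh t + B * sinh t)).
Proof.
  intros x t _.
  assert (E1 : dx (dx (fun x t => cos x * (A * cosh t + B * sinh t))) x t
    = - cos x * (A * cosh t + B * sinh t)).
  { unfold dx at 1.
    rewrite (Derive_ext _ (fun z => (- sin z) * (A * cosh t + B * sinh t))).
    - apply is_derive_unique, is_derive_scal_r.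
      auto_derive; auto; ring.
    - intros z; apply (dx_separated cos _ (fun t => A * cosh t + B * sinh t)).
      auto_derive; auto; ring. }
  assert (E2 : dt (dt (fun x t => cos x * (A * cosh t + B * sinh t))) x t
    = cos x * (A * cosh t + B * sinh t)).
  { unfold dt at 1.
    rewrite (Derive_ext _ (fun z => cos x * (B * cosh z + A * sinh z)))
      by (intros; apply dt_cos_coshsinh).
    apply is_derive_unique, (is_derive_scal (fun z => B * cosh z + A * sinh z)).
    apply is_derive_coshsinh. }
  rewrite E1, E2; ring.
Qed.

Lemma harmonic_const T c : harmonic T (fun _ _ => c).
Proof.
  intros x t _.
  assert (E1 : dx (dx (fun _ _ => c)) x t = 0).
  { unfold dx; rewrite (Derive_ext _ (fun _ => 0)) by (intros; apply Derive_const).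
    apply Derive_const. }
  assert (E2 : dt (dt (fun _ _ => c)) x t = 0).
  { unfold dt; rewrite (Derive_ext _ (fun _ => 0)) by (intros; apply Derive_const).
    apply Derive_const. }
  rewrite E1, E2; ring.
Qed.

(** With S = sinh T and C = cosh T the quadratic is, up to sign, the determinant
    of the two boundary conditions on the coefficients of cosh and sinh.  It is
    positive at 0, and at the right end of the interval it equals
    - 2 S^3 (a - b)^2 / (C (a + b)^2). *)
Lemma characteristic_root (S C a b : R) : 0 < S -> 0 < C -> 0 < a -> 0 < b ->
  exists s, 0 <= s <= 2 * S / (C * (a + b)) /\
    2 * S * C - s * (a + b) * (C * C + S * S) + 2 * (s * s) * (a * b) * (S * C) = 0.
Proof.
  intros HS HC Ha Hb.
  set (m := 2 * S / (C * (a + b))).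
  assert (Hm : 0 < m) by (apply Rdiv_lt_0_compat; nra).
  set (p := fun s => 2 * S * C - s * (a + b) * (C * C + S * S)
    + 2 * (s * s) * (a * b) * (S * C)).
  assert (P0 : 0 < p 0) by (unfold p; assert (0 < S * C) by nra; lra).
  assert (Pm : p m <= 0).
  { replace (p m) with (- (2 * (S * S * S) * ((a - b) * (a - b)) / (C * ((a + b) * (a + b)))))
      by (unfold p, m; field; split; lra).
    assert (0 <= 2 * (S * S * S) * ((a - b) * (a - b)) / (C * ((a + b) * (a + b)))); [|lra].
    apply Rle_mult_inv_pos; [|assert (0 < (a + b) * (a + b)) by nra; nra].
    assert (0 < S * S * S) by (assert (0 < S * S) by nra; nra).
    assert (0 <= (a - b) * (a - b)) by apply Rle_0_sqr.
    apply Rmult_le_pos; lra. }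
  destruct (IVT_cor p 0 m) as [s [Hs E]].
  - intros s; apply continuity_pt_filterlim.
    assert (D : ex_derive p s) by (unfold p; auto_derive; exact I).
    destruct D as [l D]; exact (is_derive_continuous p s l D).
  - lra.
  - nra.
  - exists s; split; auto.
Qed.

Lemma Rbar_le_mult_pos (s : Rbar) (m L : R) : 0 < L ->
  Rbar_le s (Finite m) -> Rbar_le (Rbar_mult s (Finite L)) (Finite (m * L)).
Proof.
  intros HL; destruct s as [s| |]; simpl.
  - intros H; apply Rmult_le_compat_r; lra.
  - tauto.
  - intros _; destruct (Rle_dec 0 L) as [H|H]; [|lra].
    destruct (Rle_lt_or_eq_dec 0 L H); simpl; auto; lra.
Qed.

Lemma Rbar_mult_pos_le (s : Rbar) (m L : R) : 0 < L ->
  Rbar_le (Finite m) s -> Rbar_le (Finite (m * L)) (Rbar_mult s (Finite L)).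
Proof.
  intros HL; destruct s as [s| |]; simpl.
  - intros H; apply Rmult_le_compat_r; lra.
  - intros _; destruct (Rle_dec 0 L) as [H|H]; [|lra].
    destruct (Rle_lt_or_eq_dec 0 L H); simpl; auto; lra.
  - tauto.
Qed.

(** The root of the characteristic equation is an eigenvalue at most
    2 tanh T / (a + b), and the length is 2 pi (a + b).  Independence of the
    eigenfunction from the constants follows from the sign change of cos between
    x = 0 and x = pi. *)
Lemma rotational_steklov_le T (h : metric T) :
  0 < T -> conformal_class (flat_metric T) h -> rotationally_symmetric h ->
  Rbar_le (steklov_bar h 1) (Finite (4 * PI * tanh T)).
Proof.
  intros HT C Rot; assert (PP := PI_RGT_0).
  assert (TI := in_cylinder_top T HT).
  assert (BI := in_cylinder_bottom T HT).
  assert (R0 : forall x t, in_cylinder T t -> g11 h x t = g11 h 0 t).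
  { intros x t Ht; destruct (Rot x 0 t Ht) as [E _]; now rewrite Rplus_0_l in E. }
  set (a := sqrt (g11 h 0 T)); set (b := sqrt (g11 h 0 (- T))).
  assert (Ha : 0 < a) by (apply sqrt_lt_R0, (conformal_components T h 0 T C TI)).
  assert (Hb : 0 < b) by (apply sqrt_lt_R0, (conformal_components T h 0 (- T) C BI)).
  assert (Len : boundary_length h = 2 * PI * (a + b)).
  { unfold boundary_length.
    rewrite (RInt_eq (fun x => sqrt (g11 h x T)) (fun _ => a))
      by (intros x; unfold a; now rewrite (R0 x T TI)).
    rewrite (RInt_eq (fun x => sqrt (g11 h x (- T))) (fun _ => b))
      by (intros x; unfold b; now rewrite (R0 x (- T) BI)).
    rewrite !RInt_const; unfold scal; simpl; unfold mult; simpl; ring. }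
  assert (HS := sinh_pos T HT); assert (HC := cosh_pos T).
  assert (HQ := cosh2_sinh2 T).
  destruct (characteristic_root (sinh T) (cosh T) a b HS HC Ha Hb) as (s & Hs & E).
  (* (A, B) spans the kernel of the condition at t = T; the condition at t = -T
     then is the characteristic equation. *)
  set (A := cosh T - s * a * sinh T); set (B := - (sinh T - s * a * cosh T)).
  assert (NZ : A = 0 -> B = 0 -> False).
  { unfold A, B; intros HA HB.
    assert (cosh T * cosh T = sinh T * sinh T); [|lra].
    transitivity (s * a * sinh T * cosh T); [|nra].
    replace (cosh T) with (s * a * sinh T) at 1 by lra; ring. }
  set (v := fun x t : R => cos x * (A * cosh t + B * sinh t)).
  assert (LI : forall c0 c1, (forall x t, in_cylinder T t -> c0 * 1 + c1 * v x t = 0) ->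
    c0 = 0 /\ c1 = 0).
  { intros c0 c1 H; unfold v in H.
    assert (H1 := H 0 T TI); assert (H2 := H PI T TI).
    assert (OI : in_cylinder T 0) by (unfold in_cylinder; lra).
    assert (H3 := H 0 0 OI).
    rewrite ?cos_0, ?cos_PI, ?cosh_0, ?sinh_0 in *.
    assert (c0 = 0) by lra; split; auto.
    destruct (Req_dec c1 0) as [Z|N]; auto; exfalso; subst c0.
    assert (ZA : A = 0) by (apply Rmult_eq_reg_l with c1; lra).
    apply NZ; auto; rewrite ZA in H1.
    apply Rmult_eq_reg_l with (c1 * sinh T); [lra | apply Rmult_integral_contrapositive; lra]. }
  assert (NT : exists x t, in_cylinder T t /\ v x t <> 0).
  { destruct (Req_dec A 0) as [ZA|NA].
    - exists 0, T; split; auto; unfold v; rewrite cos_0, ZA; intros Z.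
      apply NZ; auto; apply Rmult_eq_reg_l with (sinh T); lra.
    - exists 0, 0; split; [unfold in_cylinder; lra|].
      unfold v; rewrite cos_0, cosh_0, sinh_0; lra. }
  unfold steklov_bar; rewrite Len.
  replace (4 * PI * tanh T) with (2 * sinh T / (cosh T * (a + b)) * (2 * PI * (a + b)))
    by (unfold tanh; field; lra).
  apply Rbar_le_mult_pos; [nra|].
  apply (proj1 (Glb_Rbar_correct (steklov_count h 1))).
  exists (fun i => match i with O => 0 | _ => s end),
    (fun i => match i with O => fun _ _ => 1 | _ => v end); split.
  - intros [|i] _; split; try lra; apply steklov_conformal_iff; auto.
    + split; [apply smooth_const|]; split; [exists 0, T; split; [auto | lra]|].
      split; [apply harmonic_const|].
      assert (D0 : forall x t, dt (fun _ _ => 1) x t = 0)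
        by (intros; apply (Derive_const 1)).
      split; intros x; rewrite D0; ring.
    + split; [apply smooth_cos_coshsinh|]; split; [exact NT|].
      split; [apply harmonic_cos_coshsinh|].
      split; intros x; unfold v at 1; rewrite dt_cos_coshsinh, R0 by auto;
        fold a; fold b; unfold v; [|rewrite cosh_neg, sinh_neg].
      * unfold A, B; ring.
      * apply Rminus_diag_uniq.
        transitivity (cos x * (2 * sinh T * cosh T
          - s * (a + b) * (cosh T * cosh T + sinh T * sinh T)
          + 2 * (s * s) * (a * b) * (sinh T * cosh T))); [unfold A, B; ring|].
        rewrite E; ring.
  - intros c H.
    destruct (LI (c 0%nat) (c 1%nat)) as [Z0 Z1].
    + intros x t Ht; exact (H x t Ht).
    + intros [|[|i]] Hi; auto; lia.
Qed.

(** * The Poisson metric *)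

(** The Poisson kernel of the disk at the point of modulus r, without its factor
    (1 - r^2) / (2 pi). *)
Definition poisson_weight (r x : R) : R := / (1 + r * r - 2 * r * cos x).

Lemma poisson_denominator_pos r x : 0 < r < 1 -> 0 < 1 + r * r - 2 * r * cos x.
Proof. intros Hr; assert (B := COS_bound x); nra. Qed.

Lemma poisson_weight_pos r x : 0 < r < 1 -> 0 < poisson_weight r x.
Proof. intros Hr; now apply Rinv_0_lt_compat, poisson_denominator_pos. Qed.

Lemma poisson_weight_Cinf r : 0 < r < 1 -> Cinf (poisson_weight r).
Proof.
  intros Hr n; apply Cn_inv.
  - intros x; apply Rgt_not_eq, poisson_denominator_pos, Hr.
  - apply Cn_ext with (fun x => (1 + r * r) + (- (2 * r) * cos x + 0 * sin x)).
    + intros; ring.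
    + apply Cn_plus; [apply Cn_const | apply Cinf_sincos].
Qed.

Lemma poisson_weight_periodic r x : poisson_weight r (x + 2 * PI) = poisson_weight r x.
Proof.
  unfold poisson_weight; replace (x + 2 * PI) with (x + IZR 1 * (2 * PI)) by ring.
  now rewrite cos_Zperiod.
Qed.

Lemma poisson_metric_smooth r : 0 < r < 1 ->
  smooth (fun x _ => poisson_weight r x * poisson_weight r x).
Proof.
  intros Hr; apply (smooth_fst (fun x => poisson_weight r x * poisson_weight r x)).
  - apply Cinf_mult; now apply poisson_weight_Cinf.
  - intros x; now rewrite poisson_weight_periodic.
Qed.

Lemma poisson_metric_pos r : 0 < r < 1 -> forall x a b : R, (a, b) <> (0, 0) ->
  0 < poisson_weight r x * poisson_weight r x * (a * a) + 2 * 0 * (a * b)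
    + poisson_weight r x * poisson_weight r x * (b * b).
Proof.
  intros Hr x a b N; assert (P := poisson_weight_pos r x Hr).
  assert (F := flat_pos a b N).
  assert (0 < poisson_weight r x * poisson_weight r x) by nra; nra.
Qed.

Definition poisson_metric (T r : R) (Hr : 0 < r < 1) : metric T :=
  Metric (fun x _ => poisson_weight r x * poisson_weight r x) (fun _ _ => 0)
    (fun x _ => poisson_weight r x * poisson_weight r x)
    (poisson_metric_smooth r Hr) (smooth_const 0) (poisson_metric_smooth r Hr)
    (fun x t a b _ N => poisson_metric_pos r Hr x a b N).

Lemma poisson_metric_conformal T r Hr :
  conformal_class (flat_metric T) (poisson_metric T r Hr).
Proof.
  exists (fun x _ => ln (poisson_weight r x)); split.
  - apply (smooth_fst (fun x => ln (poisson_weight r x))).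
    + apply Cinf_ln; [intros; now apply poisson_weight_pos | now apply poisson_weight_Cinf].
    + intros x; now rewrite poisson_weight_periodic.
  - intros x t _; simpl.
    replace (exp (2 * ln (poisson_weight r x))) with
      (poisson_weight r x * poisson_weight r x).
    + repeat split; ring.
    + replace (2 * ln (poisson_weight r x)) with
        (ln (poisson_weight r x) + ln (poisson_weight r x)) by ring.
      rewrite exp_plus, exp_ln; auto; now apply poisson_weight_pos.
Qed.

(** With z = 2 r cos x - r^2 the weight is 1 / (1 - z), and the difference is
    z^4 / (1 - z).  An odd truncation of the geometric series is needed for the
    remainder to be nonnegative although z changes sign. *)
Lemma poisson_weight_cubic_le r x : 0 < r < 1 ->
  let z := 2 * r * cos x - r * r in 1 + z + z * z + z * z * z <= poisson_weight r x.
Proof.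
  intros Hr z; assert (P := poisson_denominator_pos r x Hr).
  unfold poisson_weight.
  replace (1 + r * r - 2 * r * cos x) with (1 - z) in * by (unfold z; ring).
  rewrite <- (Rmult_1_l (/ (1 - z))); apply Rle_div_r; auto.
  assert (0 <= (z * z) * (z * z)) by nra.
  replace ((1 + z + z * z + z * z * z) * (1 - z)) with (1 - (z * z) * (z * z)) by ring; lra.
Qed.

Lemma poisson_weight_mass_ge r : 0 < r < 1 ->
  2 * PI * (1 + r ^ 2 - 5 * r ^ 4 - r ^ 6) <= RInt (poisson_weight r) 0 (2 * PI).
Proof.
  intros Hr; assert (PP := PI_RGT_0).
  set (q := fun x => let z := 2 * r * cos x - r * r in 1 + z + z * z + z * z * z).
  assert (Cq : forall x, continuous q x).
  { intros x; unfold q; eapply is_derive_continuous; auto_derive; [exact I | reflexivity]. }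
  transitivity (RInt q 0 (2 * PI)).
  - right; symmetry.
    (* k0, k1, k2 and 8 r^3 are the coefficients of the minorant as a polynomial
       in cos x. *)
    set (k0 := 1 - r ^ 2 + r ^ 4 - r ^ 6).
    set (k1 := 2 * r * (1 - 2 * r ^ 2 + 3 * r ^ 4)).
    set (k2 := 4 * r ^ 2 * (1 - 3 * r ^ 2)).
    rewrite (RInt_FTC (fun x => k0 * x + k1 * sin x + k2 * (x + sin x * cos x) / 2
      + 8 * r ^ 3 * (sin x - sin x * sin x * sin x / 3)) q); auto.
    + rewrite sin_0, sin_2PI, cos_0, cos_2PI; unfold k0, k2; field.
    + intros x; unfold q; auto_derive; auto.
      assert (S2 : sin x * sin x = 1 - cos x * cos x).
      { assert (S2 := sin2_cos2 x); unfold Rsqr in S2; lra. }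
      transitivity (k0 + k1 * cos x + k2 * (1 + cos x * cos x - sin x * sin x) / 2
        + 8 * r ^ 3 * (cos x - (sin x * sin x) * cos x)); [field|].
      rewrite S2; unfold k0, k1, k2; field.
  - apply RInt_le; [lra| | |].
    + now apply ex_RInt_cont.
    + apply ex_RInt_cont, (Cn_continuous 0), poisson_weight_Cinf, Hr.
    + intros x _; now apply poisson_weight_cubic_le.
Qed.

(** Two eigenfunctions with smaller eigenvalues would both be constant, hence
    linearly dependent. *)
Lemma poisson_metric_steklov_ge T r Hr :
  0 < T -> 8 * r <= 1 - tanh T * tanh T -> 4 * r <= 1 - tanh T * T ->
  Rbar_le (Finite (tanh T * (1 - r * r + r * r * r))) (steklov (poisson_metric T r Hr) 1).
Proof.
  intros HT He Ho.
  apply (proj2 (Glb_Rbar_correct (steklov_count (poisson_metric T r Hr) 1))).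
  intros l (s & u & Hu & LI); simpl; apply Rnot_lt_le; intros L.
  assert (K : forall i, (i <= 1)%nat -> exists c, c <> 0 /\
    forall x t, in_cylinder T t -> u i x t = c).
  { intros i Hi; destruct (Hu i Hi) as [F Hs].
    apply steklov_conformal_iff in F; auto using poisson_metric_conformal.
    destruct F as (S & (x0 & t0 & H0 & N0) & H & B1 & B2).
    assert (E : forall x t, in_cylinder T t -> u i x t = mode (u i) 0 0 0 / (2 * PI)).
    { apply poisson_weight_rigidity with (r := r) (sigma := s i); auto; try lra.
      - intros x; rewrite B1; simpl.
        assert (P := poisson_weight_pos r x Hr); rewrite sqrt_square by lra.
        unfold poisson_weight; assert (Q := poisson_denominator_pos r x Hr); field; lra.
      - intros x; replace (dt (u i) x (- T)) with (- - dt (u i) x (- T)) by ring.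
        rewrite B2; simpl.
        assert (P := poisson_weight_pos r x Hr); rewrite sqrt_square by lra.
        unfold poisson_weight; assert (Q := poisson_denominator_pos r x Hr); field; lra. }
    exists (mode (u i) 0 0 0 / (2 * PI)); split; auto.
    rewrite <- (E x0 t0 H0); exact N0. }
  destruct (K 0%nat ltac:(lia)) as (c0 & N0 & E0).
  destruct (K 1%nat ltac:(lia)) as (c1 & N1 & E1).
  apply N1.
  apply (LI (fun i => match i with O => c1 | _ => - c0 end)) with (i := 0%nat); [|lia].
  intros x t Ht; simpl; rewrite E0, E1 by auto; ring.
Qed.

(** * The fixed point of coth *)

(** The equation coth T = T is rewritten as T tanh T = 1, whose left side is
    increasing as a product of increasing positive functions. *)
Lemma mult_tanh_increasing x y : 0 < x -> x < y -> x * tanh x < y * tanh y.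
Proof.
  intros Hx Hy.
  assert (S : 0 < sinh (y - x)) by (apply sinh_pos; lra).
  rewrite sinh_minus in S.
  assert (Tx := tanh_bounds x Hx); assert (Ty := tanh_bounds y ltac:(lra)).
  assert (cx := cosh_pos x); assert (cy := cosh_pos y).
  assert (D : tanh y - tanh x = (sinh y * cosh x - cosh y * sinh x) / (cosh y * cosh x))
    by (unfold tanh; field; lra).
  assert (0 < tanh y - tanh x) by (rewrite D; apply Rdiv_lt_0_compat; nra).
  nra.
Qed.

Lemma coth_fixed_point_iff T : 0 < T -> (coth T = T <-> T * tanh T = 1).
Proof.
  intros HT; assert (s := sinh_pos T HT); assert (c := cosh_pos T).
  unfold coth, tanh; split; intros E.
  - rewrite <- E at 1; field; lra.
  - apply Rmult_eq_reg_r with (sinh T / cosh T).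
    + rewrite E; field; lra.
    + apply Rgt_not_eq, Rdiv_lt_0_compat; auto.
Qed.

Lemma coth_fixed_point_exists : exists T, 0 < T /\ coth T = T.
Proof.
  destruct (IVT_cor (fun t => t * sinh t - cosh t) 0 2) as [T [HT E]].
  - intros t; apply continuity_pt_filterlim.
    apply (is_derive_continuous (fun t => t * sinh t - cosh t) t
      ((1 * sinh t + t * cosh t) - sinh t)).
    apply (is_derive_minus (fun t => t * sinh t) cosh); [|apply is_derive_cosh].
    apply (is_derive_mult (fun t => t) sinh).
    + auto_derive; auto.
    + apply is_derive_sinh.
    + exact Rmult_comm.
  - lra.
  - rewrite sinh_0, cosh_0; unfold sinh, cosh.
    assert (H := exp_ineq1 2 ltac:(lra)).
    assert (H' : exp (Ropp 2) < 1) by (rewrite <- exp_0; apply exp_increasing; lra).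
    lra.
  - assert (P : 0 < T).
    { destruct (Req_dec T 0) as [->|N]; [|lra].
      rewrite sinh_0, cosh_0 in E; lra. }
    exists T; split; auto; apply coth_fixed_point_iff; auto.
    assert (c := cosh_pos T); unfold tanh.
    apply Rmult_eq_reg_r with (cosh T); [|lra].
    transitivity (T * sinh T); [field|]; lra.
Qed.

(** * Comparison *)

(** The bound on r serves both parity classes; it also gives r <= 1/8, which
    makes the gain r^3 in the eigenvalue bound outweigh the error -6 r^4 of the
    product of the eigenvalue and length bounds. *)
Lemma poisson_metric_exceeds T : 0 < T -> T * tanh T < 1 ->
  exists h : metric T, conformal_class (flat_metric T) h /\
    Rbar_lt (Finite (4 * PI * tanh T)) (steklov_bar h 1).
Proof.
  intros HT H1; assert (PP := PI_RGT_0); assert (L := tanh_bounds T HT).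
  set (l := tanh T) in *.
  assert (Hl2 : 0 < 1 - l * l) by nra.
  set (r := Rmin ((1 - l * l) / 8) ((1 - l * T) / 4)).
  assert (R0 : 0 < r) by (apply Rmin_pos; lra).
  assert (R1 : r <= (1 - l * l) / 8) by apply Rmin_l.
  assert (R2 : r <= (1 - l * T) / 4) by apply Rmin_r.
  assert (R3 : r <= 1 / 8) by nra.
  assert (Hr : 0 < r < 1) by lra.
  exists (poisson_metric T r Hr); split; [apply poisson_metric_conformal|].
  assert (Len : 4 * PI * (1 + r ^ 2 - 5 * r ^ 4 - r ^ 6)
    <= boundary_length (poisson_metric T r Hr)).
  { assert (M := poisson_weight_mass_ge r Hr).
    unfold boundary_length; simpl.
    rewrite (RInt_eq _ (poisson_weight r)); [lra|].
    intros x; apply sqrt_square; left; now apply poisson_weight_pos. }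
  assert (Pos : 0 < 1 + r ^ 2 - 5 * r ^ 4 - r ^ 6) .
  { assert (r * r <= 1 / 64) by nra.
    assert (0 <= r * r) by nra.
    assert (0 <= r ^ 4 <= 1 / 64) by (replace (r ^ 4) with (r * r * (r * r)) by ring; nra).
    assert (r ^ 6 <= 1 / 64) by (replace (r ^ 6) with (r ^ 4 * (r * r)) by ring; nra).
    replace (r ^ 2) with (r * r) by ring; lra. }
  set (m := l * (1 - r * r + r * r * r)).
  assert (Gap : 1 < (1 - r * r + r * r * r) * (1 + r ^ 2 - 5 * r ^ 4 - r ^ 6)).
  { assert (G : 0 < r ^ 3 * (1 - 6 * r + r ^ 2 + 4 * r ^ 3 - 5 * r ^ 4 + r ^ 5 - r ^ 6)).
    { apply Rmult_lt_0_compat; [now apply pow_lt|].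
      assert (P2 := pow_lt r 2 R0); assert (P3 := pow_lt r 3 R0).
      assert (P5 := pow_lt r 5 R0).
      replace (r ^ 4) with (r ^ 3 * r) by ring.
      replace (r ^ 6) with (r ^ 5 * r) by ring.
      nra. }
    match type of G with _ < ?X =>
      replace ((1 - r * r + r * r * r) * (1 + r ^ 2 - 5 * r ^ 4 - r ^ 6)) with (1 + X) by ring
    end; lra. }
  assert (S3 : 0 < 1 - r * r + r * r * r) by nra.
  assert (Hm : 0 < m) by (unfold m; nra).
  apply Rbar_lt_le_trans with (Finite (m * boundary_length (poisson_metric T r Hr))).
  - simpl.
    apply Rlt_le_trans with (m * (4 * PI * (1 + r ^ 2 - 5 * r ^ 4 - r ^ 6))).
    + replace (m * (4 * PI * (1 + r ^ 2 - 5 * r ^ 4 - r ^ 6))) with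
        ((4 * PI * l) * ((1 - r * r + r * r * r) * (1 + r ^ 2 - 5 * r ^ 4 - r ^ 6)))
        by (unfold m; ring).
      rewrite <- (Rmult_1_r (4 * PI * l)) at 1.
      apply Rmult_lt_compat_l; auto.
      assert (0 < PI * l) by nra; lra.
    + apply Rmult_le_compat_l; lra.
  - apply Rbar_mult_pos_le; [nra|].
    apply poisson_metric_steklov_ge; auto; unfold l in *; lra.
Qed.

Lemma flat_rotationally_symmetric T : rotationally_symmetric (flat_metric T).
Proof. intros alpha x t _; simpl; auto. Qed.

Lemma flat_conformal_refl T : conformal_class (flat_metric T) (flat_metric T).
Proof.
  exists (fun _ _ => 0); split; [apply smooth_const|].
  intros x t _; simpl; rewrite Rmult_0_r, exp_0; repeat split; ring.
Qed.

Lemma rotational_not_maximal T (h : metric T) : 0 < T -> T * tanh T < 1 ->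
  rotationally_symmetric h -> ~ conformally_maximal (flat_metric T) 1 h.
Proof.
  intros HT H1 Rot [C E].
  destruct (poisson_metric_exceeds T HT H1) as (h' & C' & L).
  assert (U := rotational_steklov_le T h HT C Rot).
  rewrite E in U; unfold conformal_sup, Rbar_lub in U.
  destruct (Rbar_ex_lub _) as [v [Hv Least]]; simpl in U.
  assert (B := Hv (steklov_bar h' 1) (ex_intro _ h' (conj C' eq_refl))).
  apply (Rbar_lt_not_le _ _ L), (Rbar_le_trans _ _ _ B U).
Qed.

Theorem theorem1p2 :
  exists T1 : R,
    unique (fun T : R => 0 < T /\ coth T = T) T1 /\
    forall T : R, 0 < T < T1 ->
      ~ conformally_maximal (flat_metric T) 1 (flat_metric T) /\
      (exists h : metric T,
         conformal_class (flat_metric T) h /\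
         Rbar_lt (steklov_bar (flat_metric T) 1) (steklov_bar h 1)) /\
      ~ (exists h : metric T,
           rotationally_symmetric h /\
           conformally_maximal (flat_metric T) 1 h).
Proof.
  destruct coth_fixed_point_exists as (T1 & P1 & E1).
  assert (E1' := proj1 (coth_fixed_point_iff T1 P1) E1).
  exists T1; split.
  - split; [auto|]; intros T2 [P2 E2].
    apply coth_fixed_point_iff in E2; auto.
    destruct (Rtotal_order T1 T2) as [L|[L|L]]; auto.
    + assert (H := mult_tanh_increasing T1 T2 P1 L); lra.
    + assert (H := mult_tanh_increasing T2 T1 P2 L); lra.
  - intros T [HT HT1].
    assert (H1 : T * tanh T < 1)
      by (rewrite <- E1'; now apply mult_tanh_increasing).
    split; [|split].
    + apply rotational_not_maximal; auto using flat_rotationally_symmetric.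
    + destruct (poisson_metric_exceeds T HT H1) as (h & C & L).
      exists h; split; auto.
      apply Rbar_le_lt_trans with (2 := L).
      apply rotational_steklov_le;
        auto using flat_rotationally_symmetric, flat_conformal_refl.
    + intros (h & Rot & M); now apply (rotational_not_maximal T h).
Qed.
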